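(* The number of open coadjoint orbits of any exponential solvable Lie group is finite and even.
   Context: An exponential (solvable) Lie group is a Lie group $G$, with Lie algebra $\mathfrak g$, whose exponential map $\exp_G\colon\mathfrak g\to G$ is bijective (such a group is automatically solvable). The coadjoint orbits of $G$ are the orbits of the coadjoint action $\mathrm{Ad}_G^*$ of $G$ on the dual space $\mathfrak g^*$; an open coadjoint orbit is one that is an open subset of $\mathfrak g^*$. The number of open orbits is allowed to be $0$.
   Formalization: The group is assumed to have positive dimension; for the trivial group the dual of the Lie algebra is a single point, which is one open coadjoint orbit, so the number of open orbits is 1 and the claim fails. *)

(* Defs.v *)
From HB Require Import structures.
From mathcomp Require Import all_boot all_order all_algebra.
From mathcomp Require Import all_classical all_reals all_analysis.
Import Order.TTheory GRing.Theory Num.Theory.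
Import numFieldNormedType.Exports.

Set Implicit Arguments.
Unset Strict Implicit.
Unset Printing Implicit Defensive.

Local Open Scope classical_set_scope.
Local Open Scope ring_scope.

(* C^k maps on an open subset U of a finite-dimensional space.  Since V has
   finite dimension, the differential is of class C^k as a map into the space
   of linear maps iff each [x |-> 'd f x v] is. *)
Fixpoint Ck (R : realType) (V W : normedModType R) (k : nat)
    (U : set V) (f : V -> W) : Prop :=
  if k is k'.+1 then
    (forall x, U x -> differentiable f x) /\
    (forall v, Ck k' U (fun x => 'd f x v))
  else forall x, U x -> {for x, continuous f}.

Definition smooth_on (R : realType) (V W : normedModType R)
    (U : set V) (f : V -> W) : Prop :=
  forall k, Ck k U f.

(* A homeomorphism from the open set [chart_dom] of M onto the open set
   [chart_cod] of R^n; [chart_coord] and [chart_uncoord] are only meaningful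
   on these sets. *)
Record chart (R : realType) (n : nat) (M : topologicalType) := Chart {
  chart_dom : set M;
  chart_cod : set 'rV[R]_n;
  chart_coord : M -> 'rV[R]_n;
  chart_uncoord : 'rV[R]_n -> M;
  chart_dom_open : open chart_dom;
  chart_cod_open : open chart_cod;
  chart_coord_cod : forall p, chart_dom p -> chart_cod (chart_coord p);
  chart_uncoord_dom : forall x, chart_cod x -> chart_dom (chart_uncoord x);
  chart_coordK : forall p, chart_dom p -> chart_uncoord (chart_coord p) = p;
  chart_uncoordK : forall x, chart_cod x -> chart_coord (chart_uncoord x) = x;
  chart_coord_continuous :
    forall p, chart_dom p -> {for p, continuous chart_coord};
  chart_uncoord_continuous :
    forall x, chart_cod x -> {for x, continuous chart_uncoord}
}.

(* Smooth n-dimensional manifolds; the atlas is the range of [chart_at]. *)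
HB.mixin Record isManifold (R : realType) (n : nat) M of Topological M := {
  manifold_hausdorff : hausdorff_space M;
  manifold_second_countable : @second_countable M;
  chart_at : M -> chart R n M;
  chart_at_dom : forall p : M, chart_dom (chart_at p) p;
  chart_at_compatible : forall p q : M,
    smooth_on
      [set x | chart_cod (chart_at p) x /\
               chart_dom (chart_at q) (chart_uncoord (chart_at p) x)]
      (chart_coord (chart_at q) \o chart_uncoord (chart_at p))
}.

#[short(type="manifoldType")]
HB.structure Definition Manifold (R : realType) (n : nat) :=
  {M of isManifold R n M & Topological M}.

HB.mixin Record isLieGroup (R : realType) (n : nat) G
    of Group G & Manifold R n G := {
  lie_mul_continuous : continuous (fun p : G * G => (p.1 * p.2)%g);
  lie_mul_smooth : forall a b c : G,
    smooth_on
      [set x : 'rV[R]_n * 'rV[R]_n |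
        [/\ chart_cod (chart_at a) x.1, chart_cod (chart_at b) x.2 &
            chart_dom (chart_at c) (chart_uncoord (chart_at a) x.1 *
                                    chart_uncoord (chart_at b) x.2)%g]]
      (fun x => chart_coord (chart_at c) (chart_uncoord (chart_at a) x.1 *
                                          chart_uncoord (chart_at b) x.2)%g);
  lie_inv_continuous : continuous (fun g : G => (g^-1)%g);
  lie_inv_smooth : forall a b : G,
    smooth_on
      [set x | chart_cod (chart_at a) x /\
               chart_dom (chart_at b) (chart_uncoord (chart_at a) x)^-1%g]
      (fun x => chart_coord (chart_at b) (chart_uncoord (chart_at a) x)^-1%g)
}.

#[short(type="lieGroupType")]
HB.structure Definition LieGroup (R : realType) (n : nat) :=
  {G of isLieGroup R n G & Group G & Manifold R n G}.

(* The Lie algebra, i.e. the tangent space of G at 1, is identified with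
   'rV[R]_n through the chart [chart_at 1]. *)
Section LieGroupTheory.
Context {R : realType} {n : nat} {G : lieGroupType R n}.

Definition chart1 : chart R n G := chart_at (1%g : G).

Definition smooth_curve (gamma : R -> G) : Prop :=
  continuous gamma /\
  forall a : G, smooth_on (gamma @^-1` chart_dom (chart_at a))
                          (chart_coord (chart_at a) \o gamma).

Definition one_parameter_subgroup (gamma : R -> G) : Prop :=
  smooth_curve gamma /\ {morph gamma : s t / s + t >-> (s * t)%g}.

(* The value at 1 of the one-parameter subgroup with initial velocity v; such
   a subgroup exists and is unique, so the default value is never used. *)
Definition lie_exp (v : 'rV[R]_n) : G :=
  xget 1%g [set gamma 1 | gamma in
    [set gamma | one_parameter_subgroup gamma /\
                 derive1 (chart_coord chart1 \o gamma) 0 = v]].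

(* The matrix, acting on row vectors, of the differential at 1 of the
   conjugation h |-> g h g^-1. *)
Definition Ad (g : G) : 'M[R]_n :=
  'J (fun x => chart_coord chart1 (g * chart_uncoord chart1 x * g^-1)%g)
     (chart_coord chart1 1%g).

(* The dual of the Lie algebra is 'cV[R]_n, where xi is the linear form
   v |-> v *m xi; thus (Ad^*_g xi)(v) = xi(Ad_(g^-1) v). *)
Definition coAd (g : G) (xi : 'cV[R]_n) : 'cV[R]_n := Ad g^-1%g *m xi.

Definition coadjoint_orbit (xi : 'cV[R]_n) : set 'cV[R]_n :=
  [set coAd g xi | g in [set: G]].

End LieGroupTheory.

Definition exponential (R : realType) (n : nat) (G : lieGroupType R n) : Prop :=
  bijective (@lie_exp R n G).

Definition open_coadjoint_orbits (R : realType) (n : nat)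
    (G : lieGroupType R n) : set (set 'cV[R]_n) :=
  [set O | open O /\ exists xi, O = coadjoint_orbit (G := G) xi].

(* Main.v *)
Require Import Defs.
From HB Require Import structures.
From mathcomp Require Import all_boot all_order all_algebra.
From mathcomp Require Import finmap.
From mathcomp Require Import polyrcf ring lra.
From mathcomp Require Import all_classical all_reals all_analysis.
Import Order.TTheory GRing.Theory Num.Theory.
Import numFieldNormedType.Exports.
Set Implicit Arguments.
Unset Strict Implicit.
Unset Printing Implicit Defensive.
Local Open Scope classical_set_scope.
Local Open Scope ring_scope.

(** Multiplication by -1 commutes with the coadjoint action, so [O |-> - O]
    permutes the open orbits, and their number is even if no open orbit is
    mapped to itself. An orbit with [- O = O] contains some [xi] together with
    [coAd g xi = - xi]; this forces [xi = 0], because -1 is not an eigenvalue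
    of any [Ad g] ([coAd_opp_eq0]), and the orbit of 0 is not open. The
    hypothesis on the exponential map excludes the eigenvalue -1 as follows.
    Since exp is bijective and exp(2 v) = exp(v)^2, elements of G with the
    same square are equal ([square_inj]). If the square of [Ad g] fixes v,
    then h = exp v commutes with g^2, so g and h g h^-1 have the same square;
    hence g commutes with h, and [Ad g] fixes v ([Ad_fixed_square]). An
    eigenvector of [Ad g] for -1 would be fixed by the square of [Ad g] but
    not by [Ad g].

    Finiteness rests on the expansion [coAd g = 1 + A h + o(h)], where g has
    the coordinate e + h and A is linear ([coAd_expansion]). The n x n matrix
    of [z |-> A z *m xi] depends linearly on [xi], so its determinant is a
    polynomial in [xi]. Where this determinant is nonzero, all points near
    [xi] belong to the orbit of [xi] ([orbit_near]), and every point of an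
    open orbit has this property ([open_orbit_unit]). So the map sending a
    point to its orbit is locally constant on the set where the polynomial
    does not vanish, and it takes every open orbit as a value on this set. A
    locally constant function on the complement of the zeros of a polynomial
    on R^n has finitely many values ([finite_image_det_neq0]): one variable is
    eliminated at a time, the finite set of values taken on a line parallel to
    an axis being itself a locally constant function of the line, away from
    the zeros of another polynomial.

    Both facts about orbits are obtained by minimization on compact balls.
    Near a point of full rank, the point of the orbit closest to a given
    target can only be the target. For a point [xi] of an open orbit, the
    element h of least norm that carries [xi] to a given nearby point
    satisfies [k * |h| <= |A h *m xi|]; then the orbit map, which is open by
    Baire's theorem, leaves no room for a direction transverse to the range of
    [z |-> A z *m xi]. *)

(** * Locally constant functions off the zeros of a polynomial *)

Lemma near_finite_set (I T : Type) (F : set_system I) (S : set T)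
    (P : T -> I -> Prop) : Filter F -> finite_set S ->
  (forall z, S z -> \forall i \near F, P z i) ->
  \forall i \near F, forall z, S z -> P z i.
Proof.
move=> FF finS SP.
have /finite_seqP[s sE] : finite_set (S : set {classic T}) by [].
suff : \forall i \near F, forall z, z \in s -> P z i.
  by apply: filterS => i sP z; rewrite sE; exact: sP.
have {}SP z : z \in s -> \forall i \near F, P z i.
  by move=> zs; apply: SP; rewrite sE.
elim: s SP {sE} => [|z s IH] SP; first by near=> i.
have h1 := SP z (mem_head _ _).
have h2 : \forall i \near F, forall z, z \in s -> P z i.
  by apply: IH => w ws; apply: SP; rewrite inE ws orbT.
near=> i => w; rewrite inE => /orP[/eqP ->|ws]; first by near: i.
by move: w ws; near: i.
Unshelve. all: by end_near. Qed.

(** Connectedness of the segment: the set where [phi] takes the value [phi a]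
    is relatively open (as the trace of C) and relatively closed (as the trace
    of D). *)
Lemma locally_constant_segment (R : realType) (T : Type) (phi : R -> T)
    (a b : R) : a <= b ->
  (forall t, a <= t <= b -> \forall s \near t, phi s = phi t) -> phi a = phi b.
Proof.
move=> ab loc.
pose C := interior [set s | phi s = phi a].
pose D := ~` interior [set s | phi s <> phi a].
have BC : `[a, b] `&` [set s | phi s = phi a] = `[a, b] `&` C.
  apply/seteqP; split => s [sab /= sa]; split => //.
    move: sab; rewrite /= in_itv /= => /loc; rewrite /C /interior /=.
    by apply: filterS => r /= ->.
  exact: nbhs_singleton sa.
have BD : `[a, b] `&` [set s | phi s = phi a] = `[a, b] `&` D.
  apply/seteqP; split => s [sab /= sa]; split => //.
    by move=> /nbhs_singleton /=; rewrite sa.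
  move: sab; rewrite /= in_itv /= => /loc ls.
  have [//|ne] := pselect (phi s = phi a).
  by case: sa; rewrite /interior /=; apply: filterS ls => r /= ->.
have := @segment_connected R a b (`[a, b] `&` [set s | phi s = phi a]).
move=> /(_ _ _ _)/seteqP[].
- by exists a; split => //=; rewrite in_itv /= lexx.
- by exists C => //; exact: open_interior.
- by exists D => //; apply: open_closedC; exact: open_interior.
- move=> _ /(_ b) [] //=.
  by rewrite in_itv /= lexx ab.
Qed.

(** The truth values of [z < t], for z in s, tell in which gap between
    consecutive points of s the number t lies, and [phi] is constant on each
    gap. *)
Lemma finite_image_off_seq (R : realType) (T : Type) (phi : R -> T) (s : seq R) :
  (forall t, t \notin s -> \forall r \near t, phi r = phi t) ->
  finite_set [set phi t | t in [set t | t \notin s]].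
Proof.
move=> loc.
pose key t : (size s).-tuple bool := map_tuple (fun z => z < t) (in_tuple s).
have keyP t t' : t \notin s -> t' \notin s -> key t = key t' -> phi t = phi t'.
  wlog tt : t t' / t <= t' => [W nt nt' kk|].
    by case: (leP t t') => [h|/ltW h]; [|symmetry]; apply: W.
  move=> nt nt' kk; apply: locally_constant_segment => // r /andP[tr rt].
  apply: loc; apply/negP => rs.
  have kE : map (fun z => z < t) s = map (fun z => z < t') s.
    by move: kk => /(congr1 val).
  move: rs => /(nthP 0) [i si ri].
  have := congr1 (nth false ^~ i) kE.
  rewrite !(nth_map 0) // ri ltNge tr /= => /esym/negbT; rewrite -leNgt => t'r.
  have rt' : r = t' by apply/eqP; rewrite eq_le rt.
  by move: nt'; rewrite -rt' -ri mem_nth.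
have [->|/set0P [t0 t0s]] := eqVneq [set t | t \notin s] set0.
  by rewrite image_set0.
pose F (k : (size s).-tuple bool) := xget t0 [set t | t \notin s /\ key t = k].
apply: (sub_finite_set (B := (phi \o F) @` [set: (size s).-tuple bool])).
  move=> _ [t /= ts <-]; exists (key t) => //=.
  rewrite /F; case: xgetP => [r _ [rs kr]|/(_ t)]; last by case.
  exact: keyP.
exact/finite_image/finite_finset.
Qed.

Lemma mup_XsubC_factor (K : fieldType) (p : {poly K}) (t : K) : p != 0 ->
  exists2 r : {poly K}, ~~ root r t & p = r * ('X - t%:P) ^+ mup t p.
Proof.
move=> p0; have [m [r rt ->]] := multiplicity_XsubC p t.
have {}rt : ~~ root r t by move: rt; rewrite p0.
by exists r => //; rewrite mupMr // mup_XsubCX eqxx.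
Qed.

(** Characteristic 0: differentiation lowers the multiplicity of a root by
    exactly one. *)
Lemma mup_deriv_eq (R : realFieldType) (p : {poly R}) (t : R) (m : nat) :
  p != 0 -> mup t p = m.+1 -> p^`() != 0 /\ mup t p^`() = m.
Proof.
move=> p0 pm; have [r rt pE] := mup_XsubC_factor t p0.
move: pE; rewrite pm => pE.
have dE : p^`() = (r^`() * ('X - t%:P) + r *+ m.+1) * ('X - t%:P) ^+ m.
  rewrite pE derivM deriv_exp derivXsubC mul1r /= exprS.
  by rewrite [RHS]mulrDl mulrnAr mulrnAl -mulrA.
have nr : ~~ root (r^`() * ('X - t%:P) + r *+ m.+1) t.
  rewrite rootE hornerD hornerM hornerXsubC subrr mulr0 add0r hornerMn.
  by rewrite mulrn_eq0 /= -rootE.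
have d0 : p^`() != 0.
  rewrite dE mulf_neq0 ?expf_neq0 ?polyXsubC_eq0 //.
  by apply: contraNneq nr => ->; rewrite root0.
by split=> //; rewrite dE mupMr // mup_XsubCX eqxx.
Qed.

(** Here h plays the role of gcd(F, F') and q that of F / gcd(F, F'). Dividing
    by the gcd leaves each root of F with multiplicity one. The hypotheses are
    the divisibility and Bezout identities up to nonzero scalars: for
    polynomials over a ring A these identities survive the specialization of A
    at a point where the scalars do not vanish, whereas the gcd itself need
    not specialize to a gcd. *)
Lemma radical_simple_roots (R : realFieldType) (F q h q1 u v : {poly R})
    (c c1 c2 : R) (t : R) :
  F != 0 -> c != 0 -> c1 != 0 -> c2 != 0 ->
  c *: F = q * h -> c1 *: F^`() = q1 * h -> u * F + v * F^`() = c2 *: h ->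
  (root F t -> root q t) /\ (root q t -> ~~ root q^`() t).
Proof.
move=> F0 c0 c10 c20 FE dFE hE.
have qh0 : q * h != 0 by rewrite -FE scaler_eq0 negb_or c0.
have [q0 h0] : q != 0 /\ h != 0 by apply/andP; rewrite -negb_or -mulf_eq0.
have mF : mup t F = (mup t q + mup t h)%N.
  rewrite -mupM // -FE -mul_polyC mupMr // rootE hornerC //.
case FmE : (mup t F) => [|m].
  have nF : ~~ root F t.
    by rewrite -dvdp_XsubCl XsubC_dvd // FmE.
  split; first by rewrite (negPf nF).
  by move/eqP: mF; rewrite FmE eq_sym addn_eq0 => /andP[/eqP q00 _];
    rewrite -dvdp_XsubCl XsubC_dvd // q00.
have [dF0 mdF] := mup_deriv_eq F0 FmE.
have q10 : q1 != 0.
  by apply: contraNneq dF0 => q10; move/eqP: dFE; rewrite q10 mul0r scaler_eq0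
    (negPf c10).
have mdF' : m = (mup t q1 + mup t h)%N.
  by rewrite -mupM // -dFE -mul_polyC mupMr ?mdF // rootE hornerC.
have mh : (m <= mup t h)%N.
  rewrite mup_geq // -(dvdpZr _ _ c20) -hE dvdp_add // dvdp_mull // -mup_geq //.
    by rewrite FmE.
  by rewrite mdF.
have mq : mup t q = 1%N.
  have hm : mup t h = m by apply/eqP; rewrite eqn_leq mh mdF' leq_addl.
  by move/eqP: mF; rewrite FmE hm -add1n eqn_add2r => /eqP.
have rq : root q t by rewrite -dvdp_XsubCl XsubC_dvd // mq.
split=> // _.
have [r rt qE] := mup_XsubC_factor t q0.
rewrite qE mq derivM expr1 derivXsubC mulr1 rootE hornerD hornerM hornerXsubC.
by rewrite subrr mulr0 add0r -rootE.
Qed.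

Section PolynomialExtension.
Context {R : realType} {A : idomainType} {X : topologicalType}.
Variable ev : X -> {rmorphism A -> R}.
Hypothesis ev_continuous : forall f, continuous (fun x => ev x f).

Definition poly_eval (p : X * R) : {rmorphism {poly A} -> R} :=
  horner_eval p.2 \o map_poly (ev p.1).

Lemma poly_evalE p f : poly_eval p f = (map_poly (ev p.1) f).[p.2].
Proof. by []. Qed.

Lemma poly_eval_continuous f : continuous (fun p => poly_eval p f).
Proof.
have E : (fun p => poly_eval p f) =
    (fun p => \sum_(i < size f) ev p.1 f`_i * p.2 ^+ i).
  apply/funext => p; rewrite poly_evalE (@horner_coef_wide _ (size f)).
    by apply: eq_bigr => i _; rewrite coef_map.
  exact: size_poly.
rewrite E => p; apply: cvg_big => [|i _]; first exact: add_continuous.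
apply: cvgM.
  by apply: (cvg_comp fst (fun x => ev x f`_i) cvg_fst); exact: ev_continuous.
by apply: (cvg_comp snd (fun t => t ^+ i) cvg_snd); exact: exprn_continuous.
Qed.

Section Slices.
Context {T : Type}.
Variables (good : X -> Prop) (q : {poly A}) (phi : X * R -> T).
Hypothesis good_near : forall x, good x -> \forall y \near x, good y.
Hypothesis lead_neq0 : forall x, good x -> ev x (lead_coef q) != 0.
Hypothesis roots_simple : forall x t, good x ->
  poly_eval (x, t) q = 0 -> poly_eval (x, t) q^`() != 0.
Hypothesis phi_loc : forall x t, good x -> poly_eval (x, t) q != 0 ->
  \forall p \near (x, t), phi p = phi (x, t).

Definition slice_values x :=
  [set phi (x, t) | t in [set t | poly_eval (x, t) q != 0]].

Lemma slice_near x t : good x -> poly_eval (x, t) q != 0 ->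
  \forall s \near t, phi (x, s) = phi (x, t).
Proof.
move=> gx qx; have [[U V] /= [Ux Vt] UV] := phi_loc gx qx.
by apply: filterS Vt => s Vs; apply: (UV (x, s)); split => //=; exact: nbhs_singleton.
Qed.

Lemma column_near x t : good x -> poly_eval (x, t) q != 0 ->
  \forall y \near x, phi (y, t) = phi (x, t).
Proof.
move=> gx qx; have [[U V] /= [Ux Vt] UV] := phi_loc gx qx.
by apply: filterS Ux => y Uy; apply: (UV (y, t)); split => //=; exact: nbhs_singleton.
Qed.

Lemma slice_segment x a b : good x -> a <= b ->
  (forall s, a <= s <= b -> poly_eval (x, s) q != 0) -> phi (x, a) = phi (x, b).
Proof.
move=> gx ab nz.
apply: (locally_constant_segment (phi := fun s => phi (x, s))) => // s /nz.
exact: slice_near.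
Qed.

(** The values on the line over x come from the finitely many gaps between the
    roots of the specialized polynomial. *)
Lemma finite_slice_values x : good x -> finite_set (slice_values x).
Proof.
move=> gx; pose qx := map_poly (ev x) q.
have qx0 : qx != 0.
  rewrite map_poly_eq0_id0 ?lead_neq0 // -lead_coef_eq0.
  by apply: contraTneq (lead_neq0 gx) => ->; rewrite rmorph0 eqxx.
pose Z := roots qx (- cauchy_bound qx) (cauchy_bound qx).
have ZP t : (t \notin Z) = (poly_eval (x, t) q != 0).
  rewrite poly_evalE /= -/qx -rootE; congr negb.
  have [rt|nrt] := boolP (root qx t); last first.
    by apply/negbTE; apply: contra nrt => /root_roots.
  by rewrite /Z in_roots rt qx0 (root_in_cauchy_bound qx0 rt).
apply: sub_finite_set (finite_image_off_seq (phi := fun t => phi (x, t)) (s := Z) _).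
  by move=> _ [t /= tq <-]; exists t => //=; rewrite ZP.
by move=> t; rewrite ZP; exact: slice_near.
Qed.

(** When tau is a root over x, the derivative does not vanish on a window
    around (x, tau). By Rolle's theorem, a line near x has at most one root in
    the window, so each point of the window can be joined to one of its two
    ends without meeting a root, and at both ends the values do not depend on
    the line. *)
Lemma slice_values_local x (tau : R) : good x ->
  exists2 U, nbhs x U & exists2 V, nbhs tau V &
    forall y t, U y -> V t -> poly_eval (y, t) q != 0 ->
      slice_values x (phi (y, t)).
Proof.
move=> gx; have [q0|q0] := eqVneq (poly_eval (x, tau) q) 0; last first.
  have [[U V] /= [Ux Vt] UV] := phi_loc gx q0.
  exists U => //; exists V => // y t Uy Vt' _; exists tau => //=.
  by symmetry; apply: (UV (y, t)).
have := cvgr_neq0 _ (@poly_eval_continuous q^`() (x, tau)) (roots_simple gx q0).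
case=> -[U V] /= [Ux Vtau] UV.
have [e e0 eV] : exists2 e, 0 < e & forall t, tau - e <= t <= tau + e -> V t.
  move/nbhs_ballP: (Vtau) => [d /= d0 dV].
  exists (d / 2) => [|t /andP[h1 h2]]; first by rewrite divr_gt0.
  apply: dV; rewrite /ball /= distrC ltr_distl; apply/andP; split; lra.
(* two roots in the window would enclose a zero of the derivative *)
have one_root y s t : U y -> tau - e <= s -> s < t -> t <= tau + e ->
    poly_eval (y, s) q = 0 -> poly_eval (y, t) q = 0 -> False.
  move=> Uy es st te; rewrite !poly_evalE /= => q1 q2.
  have [r] := poly_rolle st (etrans q1 (esym q2)).
  rewrite in_itv /= => /andP[sr rt]; rewrite deriv_map => qr.
  have Vr : V r by apply: eV; lra.
  by have /negP := UV (y, r) (conj Uy Vr); apply; apply/eqP; rewrite -qr.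
have xU := nbhs_singleton Ux.
have ql : poly_eval (x, tau - e) q != 0.
  by apply/eqP => ql; apply: (one_root x (tau - e) tau) => //; lra.
have qr : poly_eval (x, tau + e) q != 0.
  by apply/eqP => qr; apply: (one_root x tau (tau + e)) => //; lra.
have W : \forall y \near x, [/\ U y, good y, phi (y, tau - e) = phi (x, tau - e) &
    phi (y, tau + e) = phi (x, tau + e)].
  have h1 := column_near gx ql; have h2 := column_near gx qr.
  by near=> y; split; near: y => //; exact: good_near.
exists [set y | [/\ U y, good y, phi (y, tau - e) = phi (x, tau - e) &
    phi (y, tau + e) = phi (x, tau + e)]] => //.
exists `]tau - e, tau + e[%classic.
  by apply: near_in_itvoo; rewrite in_itv /=; apply/andP; split; lra.
move=> y t /= [Uy gy yl yr]; rewrite in_itv /= => /andP[tl tr] qt.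
have [[s [/andP[ts se] qs]]|nos] :=
    pselect (exists s, t <= s <= tau + e /\ poly_eval (y, s) q = 0).
  exists (tau - e) => //=; rewrite -yl; apply: slice_segment => //; first exact: ltW.
  move=> r /andP[er rt]; apply/eqP => qr0.
  have tls : t < s.
    by rewrite lt_neqAle ts andbT; apply: contraNneq qt => ->; exact/eqP.
  by apply: (one_root y r s) => //; lra.
exists (tau + e) => //=; rewrite -yr; symmetry; apply: slice_segment => //; first exact: ltW.
by move=> s ts; apply/eqP => qs; apply: nos; exists s.
Unshelve. all: by end_near. Qed.

(** This makes the bound on the roots uniform over the lines near x. *)
Lemma cauchy_bound_continuous x : good x ->
  (fun y => cauchy_bound (map_poly (ev y) q)) @ x --> cauchy_bound (map_poly (ev x) q).
Proof.
move=> gx.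
pose B y := 1 + `|ev y (lead_coef q)|^-1 * \sum_(i < size q) `|ev y q`_i|.
have BE y : good y -> cauchy_bound (map_poly (ev y) q) = B y.
  move=> gy; rewrite /cauchy_bound /B lead_coef_map_eq ?lead_neq0 //.
  rewrite size_map_poly_id0 ?lead_neq0 //; congr (_ + _ * _).
  by apply: eq_bigr => i _; rewrite coef_map.
rewrite BE //; apply: (cvg_trans (G := B @ x)).
  by apply: near_eq_cvg; near=> y; rewrite BE //; near: y; exact: good_near.
apply: cvgD; first exact: cvg_cst.
apply: cvgM.
  by apply: cvgV; [rewrite normr_eq0 lead_neq0|apply: cvg_norm; exact: ev_continuous].
apply: cvg_big => [|i _]; first exact: add_continuous.
by apply: cvg_norm; exact: ev_continuous.
Unshelve. all: by end_near. Qed.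

(** Beyond the Cauchy bound nothing new happens, so the point can be moved
    into the segment [-M, M]; there compactness makes [slice_values_local]
    uniform. Conversely the values over x are finitely many, and each of them
    persists on nearby lines. *)
Lemma slice_values_near x : good x ->
  \forall y \near x, slice_values y = slice_values x.
Proof.
move=> gx; pose M := cauchy_bound (map_poly (ev x) q) + 1.
have tail y t : good y -> cauchy_bound (map_poly (ev y) q) <= `|t| ->
    poly_eval (y, t) q != 0.
  move=> gy; rewrite leNgt poly_evalE /=; apply: contra => /eqP; apply: cauchy_boundP.
  rewrite map_poly_eq0_id0 ?lead_neq0 // -lead_coef_eq0.
  by apply: contraTneq (lead_neq0 gy) => ->; rewrite rmorph0 eqxx.
have M0 : 0 < M by rewrite addr_gt0 // cauchy_bound_gt0.
have Mx : cauchy_bound (map_poly (ev x) q) <= M by rewrite lerDl.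
have yM : \forall y \near x, cauchy_bound (map_poly (ev y) q) < M.
  by apply: (cvgr_lt _ (cauchy_bound_continuous gx)); rewrite ltrDl.
have qM : poly_eval (x, M) q != 0 by apply: tail => //; rewrite gtr0_norm.
have qNM : poly_eval (x, - M) q != 0 by apply: tail => //; rewrite normrN gtr0_norm.
(* no new value appears over the compact segment *)
have mid : \forall y \near x, `[- M, M]%classic `<=`
    (fun t => poly_eval (y, t) q != 0 -> slice_values x (phi (y, t))).
  have := (compact_near_coveringP _).1 (@segment_compact R (- M) M).
  apply=> t _; have [U Ux [V Vt UV]] := slice_values_local t gx.
  by exists (V, U) => //= -[s y] /= [Vs Uy]; apply: UV.
(* no value disappears *)
have sup : \forall y \near x, slice_values x `<=` slice_values y.
  apply: near_finite_set; first exact: finite_slice_values.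
  move=> _ [t qt <-]; have h := column_near gx qt.
  have h' : \forall y \near x, poly_eval (y, t) q != 0.
    have [[U V] /= [Ux Vt] UV] := cvgr_neq0 _ (@poly_eval_continuous q (x, t)) qt.
    apply: filterS Ux => y Uy; apply: (UV (y, t)); split => //=; exact: nbhs_singleton.
  near=> y; exists t => /=; first by near: y.
  by near: y.
have hM := column_near gx qM; have hNM := column_near gx qNM.
near=> y; have gy : good y by near: y; exact: good_near.
apply/seteqP; split; last by near: y.
move=> _ [t /= qt <-].
have yM' : cauchy_bound (map_poly (ev y) q) < M by near: y.
have [tM|Mt] := leP `|t| M.
  by move: tM qt; rewrite ler_norml => tM; move: t tM; near: y;
    apply: filterS mid => y + t tM; apply; rewrite /= in_itv.
have [t0|t0] := leP 0 t.
  rewrite ger0_norm // in Mt.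
  exists M => //=; have <- : phi (y, M) = phi (x, M) by near: y.
  apply: slice_segment => //; first exact: ltW.
  move=> s /andP[Ms st]; apply: tail => //; apply: (le_trans (ltW yM')).
  by rewrite (le_trans Ms) // ler_norm.
rewrite ltr0_norm // in Mt.
exists (- M) => //=; have <- : phi (y, - M) = phi (x, - M) by near: y.
symmetry; apply: slice_segment => //; first lra.
move=> s /andP[Ms st]; apply: tail => //; apply: (le_trans (ltW yM')).
rewrite ltr0_norm; lra.
Unshelve. all: by end_near. Qed.
End Slices.
End PolynomialExtension.

Definition dense_nonvanishing (R : realType) (A : idomainType)
    (X : topologicalType) (ev : X -> {rmorphism A -> R}) : Prop :=
  forall f, f != 0 -> forall (x : X) U, nbhs x U -> exists2 y, U y & ev y f != 0.

(** A point x of X evaluates the elements of the ring A, which thus play the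
    part of polynomial functions on X. The codomain T is arbitrary because the
    induction on the number of variables applies the property to set-valued
    functions. *)
Definition finitely_many_pieces (R : realType) (A : idomainType)
    (X : topologicalType) (ev : X -> {rmorphism A -> R}) : Prop :=
  forall f, f != 0 -> forall (T : Type) (phi : X -> T),
    (forall x, ev x f != 0 -> \forall y \near x, phi y = phi x) ->
    finite_set [set phi x | x in [set x | ev x f != 0]].

Section PolynomialStep.
Context {R : realType} {A : idomainType} {X : topologicalType}.
Variable ev : X -> {rmorphism A -> R}.
Hypothesis ev_continuous : forall f, continuous (fun x => ev x f).
Hypothesis ev_dense : dense_nonvanishing ev.
Hypothesis ev_finite : finitely_many_pieces ev.

Lemma map_poly_ev_neq0 x (f : {poly A}) :
  ev x (lead_coef f) != 0 -> map_poly (ev x) f != 0.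
Proof.
move=> h; rewrite map_poly_eq0_id0 // -lead_coef_eq0.
by apply: contraNneq h => ->; rewrite rmorph0.
Qed.

Lemma poly_dense_nonvanishing : dense_nonvanishing (poly_eval ev).
Proof.
move=> f f0 [x t] W [[U V] /= [Ux Vt] UV].
have lf0 : lead_coef f != 0 by rewrite lead_coef_eq0.
have [y Uy yf] := ev_dense lf0 Ux.
have [r rt fE] := mup_XsubC_factor t (map_poly_ev_neq0 yf).
have [s [Vs st rs]] : exists s, [/\ V s, s != t & ~~ root r s].
  have cr : {for t, continuous (horner r)} by exact: continuous_horner.
  have nr : \forall s \near t, r.[s] != 0 by exact: cvgr_neq0 cr rt.
  have : \forall s \near t^', [/\ V s, s != t & ~~ root r s].
    have h1 := nbhs_dnbhs Vt; have h3 := nbhs_dnbhs nr.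
    have h2 := @nbhs_dnbhs_neq _ t.
    by near=> s; split; near: s.
  by move/filter_ex.
exists (y, s); first exact: UV.
change ((map_poly (ev y) f).[s] != 0).
by rewrite fE hornerM horner_exp hornerXsubC mulf_neq0 ?expf_neq0 ?subr_eq0 //.
Unshelve. all: by end_near. Qed.

(** Off the zeros of g the line over x meets the zeros of F in simple roots of
    q = F / gcd(F, F'), and the finite set [slice_values x] is locally
    constant in x; so there are finitely many such sets, by the hypothesis on
    X. A point over a zero of g is covered as well: a nearby point with the
    same value lies over a nonzero value of g, by density. *)
Lemma poly_finitely_many_pieces : finitely_many_pieces (poly_eval ev).
Proof.
move=> F F0 T phi phi_loc.
have /Pdiv.Idomain.dvdpP[[c q] /= c0 qE] := dvdp_gcdl F F^`().
have /Pdiv.Idomain.dvdpP[[c1 q1] /= c10 q1E] := dvdp_gcdr F F^`().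
have [[u v] /= /eqpP[[d1 d2] /= /andP[d10 d20] dE]] := Bezoutp F F^`().
set h := gcdp F F^`() in qE q1E dE.
have q0 : q != 0.
  apply: contraNneq F0 => q0; move/eqP: qE.
  by rewrite q0 mul0r scale_poly_eq0 (negPf c0).
(* the scalars of the division and Bezout identities must stay nonzero,
   and the degrees of F and q must not drop, on the lines considered *)
pose g := c * c1 * d2 * lead_coef F * lead_coef q.
have g0 : g != 0 by rewrite !mulf_neq0 ?lead_coef_eq0.
pose good x := ev x g != 0.
have goodP x : good x -> [/\ ev x c != 0, ev x c1 != 0, ev x d2 != 0,
    ev x (lead_coef F) != 0 & ev x (lead_coef q) != 0].
  by rewrite /good !rmorphM /= !mulf_eq0 !negb_or -!andbA => /and5P[].
have radical x t : good x ->
    (poly_eval ev (x, t) F = 0 -> poly_eval ev (x, t) q = 0) /\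
    (poly_eval ev (x, t) q = 0 -> poly_eval ev (x, t) q^`() != 0).
  move=> /goodP[nc nc1 nd2 nF nq].
  have := @radical_simple_roots R (map_poly (ev x) F) (map_poly (ev x) q)
    (map_poly (ev x) h) (map_poly (ev x) q1) (map_poly (ev x) (d1 *: u))
    (map_poly (ev x) (d1 *: v)) (ev x c) (ev x c1) (ev x d2) t
    (map_poly_ev_neq0 nF) nc nc1 nd2.
  rewrite -!map_polyZ -!rmorphM /= deriv_map -map_polyZ -!rmorphM /= -rmorphD /=.
  rewrite qE q1E -!scalerAl -scalerDr dE map_polyZ.
  move=> /(_ erefl erefl erefl); rewrite deriv_map !rootE.
  by case=> h1 h2; split=> /eqP // /h1/eqP.
have q_neq0 x t : poly_eval ev (x, t) F != 0 -> ev x c != 0 -> poly_eval ev (x, t) q != 0.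
  move=> nF nc; apply: contraNneq nF => q00.
  have := congr1 (poly_eval ev (x, t)) qE.
  rewrite rmorphM q00 mul0r -mul_polyC rmorphM poly_evalE map_polyC hornerC => /eqP.
  by rewrite mulf_eq0 (negPf nc).
have good_near x : good x -> \forall y \near x, good y.
  by move=> gx; exact: (cvgr_neq0 _ (@ev_continuous g x) gx).
have phi_loc' x t : good x -> poly_eval ev (x, t) q != 0 ->
    \forall p \near (x, t), phi p = phi (x, t).
  move=> gx nq; apply: phi_loc; apply: contraNneq nq => F00.
  by apply/eqP; apply: (radical x t gx).1.
have lead_q x : good x -> ev x (lead_coef q) != 0 by case/goodP.
have simple x t gx := (radical x t gx).2.
have fin := ev_finite g0
  (slice_values_near ev_continuous good_near lead_q simple phi_loc').
apply: sub_finite_set (bigcup_finite fin (F := id) _); last first.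
  move=> _ [x /= gx <-]; exact: (finite_slice_values lead_q phi_loc').
move=> _ [[x t] nF <-]; rewrite -[_ (x, t)]/(is_true (poly_eval ev (x, t) F != 0)) in nF.
have near_F := cvgr_neq0 _ (@poly_eval_continuous _ _ _ ev ev_continuous F (x, t)) nF.
have [[U V] /= [Ux Vt] UV] := filterI (phi_loc _ nF) (near_F _).
have [y Uy gy] := ev_dense g0 Ux.
have [/= phiE nFy] := UV (y, t) (conj Uy (nbhs_singleton Vt)).
exists (slice_values ev q phi y); first by exists y.
by exists t => //=; apply: q_neq0 => //; case: (goodP y gy).
Qed.
End PolynomialStep.

(** A is the iterated polynomial ring R[x_0]...[x_(n-1)] and X the iterated
    product R x ... x R. The recursion starts with the constants R evaluated
    on a nonempty finite space, where both properties are immediate. *)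
Lemma polynomial_functions_model (R : realType) (n : nat) :
  exists (A : idomainType) (X : topologicalType) (ev : X -> {rmorphism A -> R})
    (coord : X -> nat -> R) (var : nat -> A) (cst : R -> A),
  [/\ (forall f, continuous (fun x => ev x f)),
      dense_nonvanishing ev /\ finitely_many_pieces ev,
      forall x i, (i < n)%N -> ev x (var i) = coord x i,
      forall x a, ev x (cst a) = a &
      forall c : nat -> R, exists x, forall i, (i < n)%N -> coord x i = c i].
Proof.
elim: n => [|n [A [X [ev [coord [var [cst]]]]]]].
  exists R, bool, (fun _ => idfun), (fun _ _ => 0), (fun _ => 0), id.
  split => //; last by exists true.
    by move=> f; exact: cst_continuous.
  split=> [f f0 x U Ux|f f0 T phi _]; first by exists x => //; exact: nbhs_singleton.
  by apply: finite_image; exact: finite_finset.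
move=> [evc [evd evf] evv evk evs].
exists {poly A}, (X * R)%type, (poly_eval ev),
  (fun p i => if i == n then p.2 else coord p.1 i),
  (fun i => if i == n then 'X else (var i)%:P), (fun a => (cst a)%:P).
split.
- exact: poly_eval_continuous.
- by split; [exact: poly_dense_nonvanishing|exact: poly_finitely_many_pieces].
- move=> [x t] i; rewrite ltnS leq_eqVlt poly_evalE /=.
  have [->|_ /= ilt] := eqVneq i n; first by rewrite map_polyX hornerX.
  by rewrite map_polyC hornerC /= evv.
- by move=> [x t] a; rewrite poly_evalE map_polyC hornerC /= evk.
- move=> c; have [x xc] := evs c; exists (x, c n) => i.
  by rewrite ltnS leq_eqVlt; have [->|_] := eqVneq i n => //=; exact: xc.
Qed.

Theorem finite_image_det_neq0 (R : realType) (n : nat) (T : Type)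
    (C : 'I_n -> 'I_n -> 'I_n -> R) (phi : 'cV[R]_n -> T) :
  let M (v : 'cV[R]_n) := \matrix_(i, j) \sum_k C i j k * v k 0 in
  (forall v, \det (M v) != 0 -> \forall w \near v, phi w = phi v) ->
  finite_set [set phi v | v in [set v | \det (M v) != 0]].
Proof.
move=> M phi_loc.
have [A [X [ev [coord [var [cst [evc [_ evf] evv evk evs]]]]]]] :=
  polynomial_functions_model R n.
pose vec x : 'cV[R]_n := \col_i coord x i.
pose D := \det (\matrix_(i, j) \sum_k cst (C i j k) * var k).
have DE x : ev x D = \det (M (vec x)).
  rewrite -det_map_mx; congr (\det _); apply/matrixP => i j; rewrite !mxE rmorph_sum.
  by apply: eq_bigr => k _; rewrite rmorphM evk evv // mxE.
have vec_continuous : continuous vec.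
  move=> x; apply/cvg_ballP => e e0.
  have : \forall y \near x, forall k : 'I_n, ball (vec x k 0) e (vec y k 0).
    apply: filter_forall => k.
    have := evc (var k) x; move=> /cvg_ballP/(_ _ e0); apply: filterS => y.
    by rewrite !mxE !evv.
  by apply: filterS => y H; split=> // i j; rewrite (ord1 j).
have vec_surj v : exists x, vec x = v.
  have [x xc] := evs (fun i => if insub i is Some k then v k 0 else 0).
  by exists x; apply/colP => i; rewrite mxE xc // valK.
have [D0|D0] := eqVneq D 0.
  suff -> : [set v | \det (M v) != 0] = set0 by rewrite image_set0.
  apply/seteqP; split=> // v /=; have [x <-] := vec_surj v.
  by rewrite -DE D0 rmorph0 eqxx.
apply: sub_finite_set (evf D D0 _ (phi \o vec) _); last first.
  move=> x; rewrite DE => /phi_loc; exact: vec_continuous.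
move=> _ [v /= Dv <-]; have [x xv] := vec_surj v.
by exists x => /=; rewrite ?DE xv.
Qed.

(** * Differentials *)

(** Differentials are defined with little-o; explicit epsilon bounds are
    easier to add and to compose with norm estimates. *)
Lemma is_diffP (R : realType) (V W : normedModType R) (f : V -> W) (x : V)
    (df : {linear V -> W}) : continuous df ->
  is_diff x f df <->
  forall eps, 0 < eps ->
    \forall h \near 0, `|f (x + h) - f x - df h| <= eps * `|h|.
Proof.
move=> dfc; have E h : (f \o shift x - (cst (f x) + df)) h = f (x + h) - f x - df h.
  by rewrite -[LHS]/(f (h + x) - (f x + df h)) opprD addrA (addrC h).
split=> [[/diff_locally fx dfE]|H].
  rewrite dfE in fx; move/eqaddoP: fx => fx eps e0.
  by have := fx _ e0; apply: filterS => h; rewrite E.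
have fx : f \o shift x = cst (f x) + df +o_ 0 id.
  apply/eqaddoP => eps e0; have := H _ e0; apply: filterS => h.
  by rewrite E.
have dE := diff_unique dfc fx.
split=> //; apply/diff_locallyP; split; rewrite dE //.
Qed.

Lemma near_eq_is_diff (R : realType) (V W : normedModType R) (f g : V -> W)
    (x : V) : (\forall y \near x, f y = g y) -> differentiable f x ->
  differentiable g x /\ 'd g x = 'd f x :> (V -> W).
Proof.
move=> fg df.
have dfc : continuous ('d f x) by apply: diff_continuous.
suff h : is_diff x g ('d f x) by split; [exact: ex_diff|exact: diff_val].
apply/is_diffP => // eps e0.
have /(is_diffP f x dfc)/(_ _ e0) h := differentiableP df.
have fg0 : \forall h \near (0 : V), f (x + h) = g (x + h).
  move: fg; rewrite (near_shift 0 x) subr0.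
  by apply: filterS => k; rewrite /= addrC.
near=> y; rewrite -(nbhs_singleton fg).
have <- : f (x + y) = g (x + y) by near: y.
by near: y.
Unshelve. all: by end_near. Qed.

Lemma near_eq_diff (R : realType) (V W : normedModType R) (f g : V -> W)
    (x v : V) : (\forall y \near x, f y = g y) -> differentiable f x ->
  'd g x v = 'd f x v.
Proof. by move=> fg /(near_eq_is_diff fg)[_ E]; exact: (congr1 (fun h => h v) E). Qed.

Lemma diff_comp_at (R : realType) (U V W : normedModType R) (f : U -> V) (g : V -> W)
    (x : U) (y : V) v : differentiable f x -> f x = y -> differentiable g y ->
  differentiable (g \o f) x /\ 'd (g \o f) x v = 'd g y ('d f x v).
Proof.
move=> df fx; rewrite -fx => dg; split; first exact: differentiable_comp.
by rewrite diff_comp.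
Qed.

Lemma diff_pairr (R : realType) (V W : normedModType R) (x : V) (y w : W) :
  'd (fun z => (x, z)) y w = (0, w).
Proof.
have h : is_diff y (fun z => (x, z)) (fun z => ((0 : W -> V) z, id z)).
  exact: is_diff_pair.
exact: (congr1 (fun f => f w) (@diff_val _ _ _ _ _ _ _ h)).
Qed.

Lemma diff_pairl (R : realType) (V W : normedModType R) (x : V) (y w : W) :
  'd (fun z => (z, x)) y w = (w, 0).
Proof.
have h : is_diff y (fun z => (z, x)) (fun z => (id z, (0 : W -> V) z)).
  exact: is_diff_pair.
exact: (congr1 (fun f => f w) (@diff_val _ _ _ _ _ _ _ h)).
Qed.

Section Smooth.
Context {R : realType} {V W : normedModType R}.
Implicit Types (U : set V) (f : V -> W).

Lemma smooth_differentiable U f x : smooth_on U f -> U x -> differentiable f x.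
Proof. by move=> /(_ 1%N) [+ _]; exact. Qed.

Lemma smooth_diff_differentiable U f x v : smooth_on U f -> U x ->
  differentiable (fun y => 'd f y v) x.
Proof. by move=> /(_ 2%N) [_ /(_ v)] [+ _]; exact. Qed.
End Smooth.

(** Differentials at an arbitrary point are deduced in this form from the
    differential at the identity of a group, by translation. *)
Lemma is_diff_shift (R : realType) (V W : normedModType R) (f : V -> W) (x v : V) :
  differentiable (fun h => f (x + h)) 0 ->
  differentiable f x /\ 'd f x v = 'd (fun h => f (x + h)) 0 v.
Proof.
move=> d; set g := fun h => _ in d *.
have dc : continuous ('d g 0) by apply: diff_continuous.
suff h : is_diff x f ('d g 0).
  by split; [exact: ex_diff|exact: (congr1 (fun k => k v) (@diff_val _ _ _ _ _ _ _ h))].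
apply/(is_diffP f x dc) => eps e0.
have := (is_diffP g 0 dc).1 (differentiableP d) eps e0.
by apply: filterS => h; rewrite /g add0r addr0.
Qed.

(** The mean value theorem, applied to each entry. *)
Lemma constant_of_diff_eq0 (R : realType) (n : nat) (f : R -> 'rV[R]_n) (r : R) :
  (forall t, `|t| < r -> differentiable f t /\ 'd f t 1 = 0) ->
  forall t, `|t| < r -> f t = f 0.
Proof.
move=> df t tr; apply/rowP => j; pose g s := f s 0 j.
have dg (s : R) : `|s| < r -> is_derive s 1 g 0.
  move=> /df[dfs dfs0].
  have dcoord : differentiable (fun M : 'rV[R]_n => M 0 j) (f s) by exact: differentiable_coord.
  have [dg dgE] := diff_comp_at (1 : R) dfs erefl dcoord.
  have dg' : differentiable g s by exact: dg.
  apply: DeriveDef; first exact/derivable1_diffP.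
  rewrite deriveE //; apply: (etrans dgE).
  by rewrite dfs0 linear0.
suff H (a b : R) : a <= b -> `|a| < r -> `|b| < r -> g a = g b.
  have r0 : `|0 : R| < r by rewrite normr0 (le_lt_trans _ tr).
  by case: (leP t 0) => [t0|/ltW t0]; [|symmetry]; apply: H.
move=> ab ar br.
have inr (s : R) : a <= s <= b -> `|s| < r.
  move=> /andP[as_ sb]; move: ar br; rewrite !ltr_norml => /andP[h1 h2] /andP[h3 h4].
  by apply/andP; split; lra.
have [||s _] := @MVT_segment R g (fun _ => 0) a b ab.
- by move=> s; rewrite in_itv /= => /andP[/ltW h1 /ltW h2]; apply/dg/inr; rewrite h1.
- apply: derivable_within_continuous => s; rewrite in_itv /= => /inr/dg[h _]; exact: h.
by rewrite mul0r => /eqP; rewrite subr_eq0 => /eqP.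
Qed.

(** * Reparametrization of smooth curves *)

Section SmoothReparametrization.
Context {R : realType} {V W : normedModType R}.

Lemma Ck_congr (k : nat) (U : set V) (f g : V -> W) : open U ->
  (forall x, U x -> f x = g x) -> Ck k U f -> Ck k U g.
Proof.
move=> oU; elim: k f g => [|k IH] f g fg /=.
  move=> cf x Ux; have cfx : f y @[y --> x] --> f x := cf x Ux.
  rewrite (fg x Ux) in cfx; apply: cvg_trans cfx; apply: near_eq_cvg.
  by apply: filterS (open_nbhs_nbhs (conj oU Ux)) => y Uy; exact: fg.
have near_fg x : U x -> \forall y \near x, f y = g y.
  by move=> Ux; apply: filterS (open_nbhs_nbhs (conj oU Ux)) => y; exact: fg.
move=> [df dk]; split=> [x Ux|v].
  exact: (near_eq_is_diff (near_fg x Ux) (df x Ux)).1.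
apply: IH (dk v) => x Ux.
exact: (esym (near_eq_diff v (near_fg x Ux) (df x Ux))).
Qed.

Lemma Ck_cst (k : nat) (U : set V) (w : W) : Ck k U (fun=> w).
Proof.
elim: k w => [|k IH] w /=; first by move=> x _; exact: cst_continuous.
split=> [x _|v]; first exact: differentiable_cst.
rewrite (_ : (fun x => 'd (fun=> w) x v) = fun=> 0); first exact: IH.
by apply/funext => x; have /= := congr1 (fun f => f v) (diff_cst w x).
Qed.
End SmoothReparametrization.

(** For a curve read in a chart, this keeps [t |-> gamma (t * a)] smooth. *)
Lemma Ck_scale (R : realType) (W : normedModType R) (k : nat) (U : set R)
    (f : R -> W) (a : R) : open U -> Ck k U f ->
  Ck k ((fun t : R => t * a) @^-1` U) (fun t => f (t * a)).
Proof.
move=> oU; elim: k f => [|k IH] f /=.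
  move=> cf x Ux; apply: (cvg_comp (fun t : R => t * a) f _ (cf _ Ux)).
  exact: mulrr_continuous.
have sd (x : R) : is_diff x (fun t : R => t * a) (fun t : R => t * a).
  exact: (is_diff_scalel x a).
move=> [df dk].
have dfa (x v : R) : U (x * a) -> differentiable (fun t : R => f (t * a)) x /\
    'd (fun t : R => f (t * a)) x v = 'd f (x * a) (v * a).
  move=> Ux; have [d E] := diff_comp_at v (@ex_diff _ _ _ _ _ _ _ (sd x)) erefl (df _ Ux).
  split; first exact: d.
  apply: (etrans E); congr ('d f _ _).
  exact: (congr1 (fun f => f v) (@diff_val _ _ _ _ _ _ _ (sd x))).
split=> [x Ux|v]; first exact: (dfa x 0 Ux).1.
apply: (Ck_congr _ _ (IH _ (dk (v * a)))).
  by apply: open_comp => // x _; exact: mulrr_continuous.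
by move=> x Ux; symmetry; exact: (dfa x v Ux).2.
Qed.

(** * Norms, limits and expansions of matrices *)

Section MatrixNorm.
Context {R : realType}.

Lemma ler_mx_entry (m n : nat) (M : 'M[R]_(m, n)) i j : `|M i j| <= `|M|.
Proof.
rewrite [leRHS]/Num.Def.normr/= mx_normrE.
exact: (le_bigmax _ (fun ij : 'I_m * 'I_n => `|M ij.1 ij.2|) (i, j)).
Qed.

Lemma mx_norm_le (m n : nat) (M : 'M[R]_(m, n)) (r : R) : 0 <= r ->
  (forall i j, `|M i j| <= r) -> `|M| <= r.
Proof.
by move=> r0 Mr; rewrite [leLHS]/Num.Def.normr/= mx_normrE bigmax_le // => ij _.
Qed.

Lemma mulmx_norm_le (m n p : nat) (M : 'M[R]_(m, n)) (N : 'M[R]_(n, p)) :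
  `|M *m N| <= n%:R * `|M| * `|N|.
Proof.
apply: mx_norm_le => [|i j]; first by rewrite !mulr_ge0.
rewrite mxE; apply: (le_trans (ler_norm_sum _ _ _)).
rewrite -mulrA -[X in X%:R * _]card_ord -sum1_card natr_sum mulr_suml ler_sum // => k _.
by rewrite mul1r normrM ler_pM // ler_mx_entry.
Qed.

End MatrixNorm.

(* Together with the norm, this makes matrices a complete normed module, as
   Baire's theorem requires. *)
HB.instance Definition _ (R : realType) (m n : nat) := Complete.on 'M[R]_(m, n).

Section MatrixLimits.
Context {R : realType}.

Lemma mulmx_cvgr (m n p : nat) (M : 'M[R]_(m, n)) (N : 'M[R]_(n, p))
    (T : Type) (F : set_system T) (f : T -> 'M[R]_(n, p)) : Filter F ->
  f x @[x --> F] --> N -> M *m f x @[x --> F] --> M *m N.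
Proof.
move=> FF /cvgrPdist_le fN; apply/cvgrPdist_le => eps e0.
have d0 : 0 < eps / (n%:R * `|M| + 1) by rewrite divr_gt0 // ltr_wpDl.
have := fN _ d0; apply: filterS => x h.
rewrite -mulmxBr; apply: (le_trans (mulmx_norm_le _ _)).
apply: (le_trans (ler_wpM2l _ h)); first by rewrite mulr_ge0.
rewrite mulrCA ger_pMr // ler_pdivrMr ?ltr_wpDl // mul1r lerDl //.
Qed.

Lemma mulmx_cvgl (m n p : nat) (M : 'M[R]_(m, n)) (N : 'M[R]_(n, p))
    (T : Type) (F : set_system T) (f : T -> 'M[R]_(m, n)) : Filter F ->
  f x @[x --> F] --> M -> f x *m N @[x --> F] --> M *m N.
Proof.
move=> FF /cvgrPdist_le fN; apply/cvgrPdist_le => eps e0.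
have d0 : 0 < eps / (n%:R * `|N| + 1) by rewrite divr_gt0 // ltr_wpDl.
have := fN _ d0; apply: filterS => x h.
rewrite -mulmxBl; apply: (le_trans (mulmx_norm_le _ _)); rewrite mulrAC.
apply: (le_trans (ler_wpM2l _ h)); first by rewrite mulr_ge0.
rewrite mulrCA ger_pMr // ler_pdivrMr ?ltr_wpDl // mul1r lerDl //.
Qed.

Lemma mx_norm_tr (m n : nat) (M : 'M[R]_(m, n)) : `|M^T| = `|M|.
Proof.
apply/eqP; rewrite eq_le; apply/andP; split; apply: mx_norm_le => // i j.
  by rewrite mxE ler_mx_entry.
by have := ler_mx_entry M^T j i; rewrite mxE.
Qed.

Lemma compact_norm_le (n : nat) (r : R) : compact [set h : 'rV[R]_n | `|h| <= r].
Proof.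
apply: bounded_closed_compact.
  by exists r; split; [exact: num_real|] => s rs h /= hr; apply: (le_trans hr); exact: ltW.
apply: (@closed_comp _ _ (fun h : 'rV[R]_n => `|h|) [set t | t <= r]).
  by move=> h _; exact: norm_continuous.
exact: closed_le.
Qed.
End MatrixLimits.

Lemma near0_norm_le (R : realType) (V : normedModType R) (P : set V) :
  (\forall h \near (0 : V), P h) -> exists2 r : R, 0 < r & forall h, `|h| <= r -> P h.
Proof.
move=> /nbhs_norm0P[r /= r0 rP]; exists (r / 2); first by rewrite divr_gt0.
by move=> h hr; apply: rP; apply: (le_lt_trans hr); rewrite ltr_pdivrMr // ltr_pMr // ltr1n.
Qed.

Lemma unitmx_inj (R : fieldType) (n : nat) (M : 'M[R]_n) :
  (forall z : 'rV[R]_n, z *m M = 0 -> z = 0) -> M \in unitmx.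
Proof.
move=> inj; rewrite -row_free_unit -kermx_eq0; apply/eqP/row_matrixP => i; rewrite row0.
by apply: inj; rewrite -row_mul mulmx_ker row0.
Qed.

Lemma linear_rV_bounded (R : realType) (n : nat) (V : normedModType R)
    (f : {linear 'rV[R]_n -> V}) : exists2 C, 0 < C & forall h, `|f h| <= C * `|h|.
Proof.
exists (1 + \sum_k `|f (delta_mx 0 k)|) => [|h].
  by rewrite ltr_pwDl // sumr_ge0.
rewrite {1}(row_sum_delta h) linear_sum.
apply: (le_trans (ler_norm_sum _ _ _)); rewrite mulrDl mul1r.
rewrite ler_wpDl // mulr_suml ler_sum // => k _.
by rewrite linearZ normrZ mulrC ler_wpM2l // ler_mx_entry.
Qed.

Lemma linear_rV_continuous (R : realType) (n : nat) (V : normedModType R)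
    (f : {linear 'rV[R]_n -> V}) : continuous f.
Proof.
have [C C0 CP] := linear_rV_bounded f.
move=> x; have FF : Filter (nbhs x) by exact: nbhs_filter.
apply/(@cvgrPdist_le _ _ _ _ FF) => eps e0.
have : \forall y \near x, `|x - y| <= eps / C.
  apply/nbhs_normP; exists (eps / C); first by rewrite /= divr_gt0.
  by move=> y /= /ltW.
apply: filterS => y h; rewrite -linearB; apply: (le_trans (CP _)).
by rewrite mulrC -ler_pdivlMr.
Qed.

(** The matrix of [f y] collects the images of the basis vectors, and each of
    them is differentiable in y; the expansions of the rows form an expansion
    of the matrix. *)
Lemma lin1_mx_expansion (R : realType) (n : nat) (f : 'rV[R]_n -> 'rV[R]_n -> 'rV[R]_n)
    (x : 'rV[R]_n) (M : 'M[R]_n) : lin1_mx (f x) = M -> (forall v, differentiable (f ^~ v) x) ->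
  exists D : {linear 'rV[R]_n -> 'M[R]_n}, forall eps, 0 < eps ->
    \forall h \near (0 : 'rV[R]_n), `|lin1_mx (f (x + h)) - M - D h| <= eps * `|h|.
Proof.
move=> <- df.
pose D h : 'M[R]_n := \matrix_(i, j) ('d (f ^~ (delta_mx 0 i)) x h) 0 j.
have D_lin : linear D.
  by move=> a v w; apply/matrixP => i j; rewrite !mxE linearP !mxE.
pose D' : {linear 'rV[R]_n -> 'M[R]_n} := HB.pack D (GRing.isLinear.Build R _ _ _ D D_lin).
exists D' => eps e0.
have : \forall h \near (0 : 'rV[R]_n), forall i : 'I_n, `|f (x + h) (delta_mx 0 i) - f x (delta_mx 0 i) -
    'd (f ^~ (delta_mx 0 i)) x h| <= eps * `|h|.
  apply: (@filter_forall _ _ (fun i (h : 'rV[R]_n) => `|f (x + h) (delta_mx 0 i) -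
    f x (delta_mx 0 i) - 'd (f ^~ (delta_mx 0 i)) x h| <= eps * `|h|) (nbhs (0 : 'rV[R]_n))) => i.
  have dfi := df (delta_mx 0 i).
  have dfc : continuous ('d (f ^~ (delta_mx 0 i)) x) by apply: diff_continuous.
  exact: ((is_diffP (f ^~ (delta_mx 0 i)) x dfc).1 (differentiableP dfi) eps e0).
apply: filterS => h H; apply: mx_norm_le => [|i j]; first by rewrite mulr_ge0 // ltW.
apply: le_trans (H i); apply: le_trans (ler_mx_entry _ 0 j).
by rewrite !mxE.
Qed.

(** Arithmetic of [quotient_first_order]: E stands for |T - 1|, EY for the
    norm of (T - 1)(Y - 1), and D for the errors of the expansions of X and Y.
    The first smallness condition on h gives E = O(h), and then EY = O(h^2) is
    absorbed in [eps * h] by the second one. *)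
Lemma quotient_arith (R : realFieldType) (N C h eps E EY D : R) :
  0 <= N -> 1 <= C -> 0 <= h -> 0 <= E -> E <= C * h + C * h + EY ->
  EY <= N * E * (C * h) -> h * (2 * (N * C + 1)) <= 1 ->
  h * (8 * (N * C * C + 1)) <= eps -> D <= eps / 4 * h + eps / 4 * h ->
  D + EY <= eps * h.
Proof.
move=> N0 C1 h0 E0 HE HEY h1 h2 HD.
have NC : N * C * h <= 2^-1 by nra.
have {}HE : E <= 4 * (C * h) by nra.
have Ch0 : 0 <= C * h by nra.
have {}HEY : EY <= N * (4 * (C * h)) * (C * h).
  by apply: (le_trans HEY); rewrite ler_wpM2r // ler_wpM2l.
nra.
Qed.

(** First-order expansion of the quotient T of X by Y, without inverting Y: T
    - 1 = (X - 1) - (Y - 1) - (T - 1)(Y - 1), and the product is of second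
    order. *)
Lemma quotient_first_order (R : realType) (n : nat) (T X Y P B : 'M[R]_n)
    (C eps h : R) : T *m Y = X -> 1 <= C -> 0 <= h ->
  `|X - 1%:M - P| <= eps / 4 * h -> `|Y - 1%:M - B| <= eps / 4 * h ->
  `|X - 1%:M| <= C * h -> `|Y - 1%:M| <= C * h ->
  h * (2 * (n%:R * C + 1)) <= 1 -> h * (8 * (n%:R * C * C + 1)) <= eps ->
  `|T - 1%:M - (P - B)| <= eps * h.
Proof.
move=> TY C1 h0 HX HY X1 Y1 h1 h2.
have TE : T - 1%:M = (X - 1%:M) - (Y - 1%:M) - (T - 1%:M) *m (Y - 1%:M).
  have -> : (T - 1%:M) *m (Y - 1%:M) = X - T - (Y - 1%:M).
    by rewrite mulmxBl mul1mx mulmxBr mulmx1 TY.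
  by move: (Y - 1%:M) => Z; rewrite opprB addrA subrK opprB [RHS]addrC addrA subrK.
have -> : T - 1%:M - (P - B) =
    (X - 1%:M - P) - (Y - 1%:M - B) - (T - 1%:M) *m (Y - 1%:M).
  rewrite {1}TE; move: (X - 1%:M) (Y - 1%:M) (_ *m _) => x y z.
  by apply/matrixP => i j; rewrite !mxE; ring.
apply: (le_trans (ler_normB _ _)).
apply: (@quotient_arith _ n%:R C h eps `|T - 1%:M|) => //.
- rewrite {1}TE; apply: (le_trans (ler_normB _ _)); rewrite lerD //.
  by apply: (le_trans (ler_normB _ _)); rewrite lerD.
- by apply: (le_trans (mulmx_norm_le _ _)); rewrite ler_wpM2l // mulr_ge0.
- by apply: (le_trans (ler_normB _ _)); rewrite lerD.
Qed.

(** * The adjoint action in the chart at the identity *)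

Section Translations.
Context {R : realType} {n : nat} {G : lieGroupType R n}.
Local Notation c := (chart_coord (@chart1 R n G)).
Local Notation u := (chart_uncoord (@chart1 R n G)).
Local Notation dom := (chart_dom (@chart1 R n G)).
Local Notation cod := (chart_cod (@chart1 R n G)).
Local Notation e := (c 1%g).

Lemma mulg_cvg (T : Type) (F : set_system T) (f g : T -> G) (a b : G) :
  Filter F -> f @ F --> a -> g @ F --> b -> (f x * g x)%g @[x --> F] --> (a * b)%g.
Proof.
move=> FF fa gb.
exact: (cvg_comp (fun x => (f x, g x)) (fun p => (p.1 * p.2)%g)
  (cvg_pair fa gb) (@lie_mul_continuous R n G (a, b))).
Qed.

Lemma invg_cvg (T : Type) (F : set_system T) (f : T -> G) (a : G) :
  Filter F -> f @ F --> a -> (f x)^-1%g @[x --> F] --> a^-1%g.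
Proof. by move=> FF fa; apply: (cvg_comp f _ fa); exact: lie_inv_continuous. Qed.

Lemma dom1 : dom 1%g. Proof. exact: chart_at_dom. Qed.

Lemma cod_e : cod e. Proof. exact/chart_coord_cod/dom1. Qed.

Lemma uncoord_e : u e = 1%g. Proof. exact/chart_coordK/dom1. Qed.

Lemma near_dom g : dom g -> \forall h \near g, dom h.
Proof. by move=> h; apply: open_nbhs_nbhs; split => //; exact: chart_dom_open. Qed.

Lemma near_cod x : cod x -> \forall y \near x, cod y.
Proof. by move=> h; apply: open_nbhs_nbhs; split => //; exact: chart_cod_open. Qed.

Lemma uncoord_cvg : u x @[x --> e] --> (1%g : G).
Proof. by rewrite -{2}uncoord_e; exact/chart_uncoord_continuous/cod_e. Qed.

Lemma coord_cvg : c g @[g --> (1%g : G)] --> e.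
Proof. exact/chart_coord_continuous/dom1. Qed.

Lemma mul_charts_differentiable (a b k : G) (x y : 'rV[R]_n) :
  chart_cod (chart_at a) x -> chart_cod (chart_at b) y ->
  chart_dom (chart_at k) (chart_uncoord (chart_at a) x * chart_uncoord (chart_at b) y)%g ->
  differentiable (fun p : 'rV[R]_n * 'rV[R]_n => chart_coord (chart_at k)
    (chart_uncoord (chart_at a) p.1 * chart_uncoord (chart_at b) p.2)%g) (x, y).
Proof.
by move=> ax bx kxy; apply: (smooth_differentiable (@lie_mul_smooth R n G a b k)).
Qed.

(** Multiplication is smooth between charts, but a and b need not lie in the
    domain of the chart at 1: the map is factored through the chart at b,
    first multiplying by b on the right, then by a on the left. *)
Lemma translation_differentiable (a b : G) : dom (a * b)%g ->
  differentiable (fun y => c (a * u y * b)%g) e.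
Proof.
move=> dab.
pose cb := chart_coord (chart_at b); pose ub := chart_uncoord (chart_at b).
have bdom : chart_dom (chart_at b) b by exact: chart_at_dom.
have adom : chart_dom (chart_at a) a by exact: chart_at_dom.
pose f1 y := cb (u y * b)%g.
pose f2 z := c (a * ub z)%g.
have d1 : differentiable f1 e.
  have df0 := @mul_charts_differentiable 1%g b b e (cb b) cod_e (chart_coord_cod bdom).
  rewrite (chart_coordK bdom) -/(@chart1 R n G) uncoord_e mul1g in df0.
  have p : differentiable (fun y : 'rV[R]_n => (y, cb b)) e by [].
  have := differentiable_comp p (df0 bdom).
  congr (differentiable _ _); apply/funext => y.
  by rewrite /= /f1 (chart_coordK bdom).
have f1e : f1 e = cb b by rewrite /f1 uncoord_e mul1g.
have d2 : differentiable f2 (f1 e).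
  have df0 := @mul_charts_differentiable a b 1%g (chart_coord (chart_at a) a) (cb b)
    (chart_coord_cod adom) (chart_coord_cod bdom).
  rewrite (chart_coordK bdom) (chart_coordK adom) -/(@chart1 R n G) in df0.
  rewrite f1e.
  have p : differentiable (fun z : 'rV[R]_n => (chart_coord (chart_at a) a, z)) (cb b) by [].
  have := differentiable_comp p (df0 dab).
  congr (differentiable _ _); apply/funext => y.
  by rewrite /= /f2 (chart_coordK adom).
apply: (near_eq_is_diff _ (differentiable_comp d1 d2)).1.
have h : (u y * b)%g @[y --> e] --> (1 * b)%g.
  exact: (mulg_cvg _ uncoord_cvg (cvg_cst b)).
rewrite mul1g in h.
have {}h : \forall y \near e, chart_dom (chart_at b) (u y * b)%g.
  by apply: h; apply: open_nbhs_nbhs; split => //; exact: chart_dom_open.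
apply: filterS h => y yd.
by rewrite /f2 /f1 /= /ub /cb (chart_coordK yd) mulgA.
Qed.
End Translations.

Section AdjointAction.
Context {R : realType} {n : nat} {G : lieGroupType R n}.
Local Notation c := (chart_coord (@chart1 R n G)).
Local Notation u := (chart_uncoord (@chart1 R n G)).
Local Notation dom := (chart_dom (@chart1 R n G)).
Local Notation cod := (chart_cod (@chart1 R n G)).
Local Notation e := (c 1%g).
Local Notation conj_chart g := (fun x => c (g * u x * g^-1)%g).

Lemma near_cod_e : \forall h \near (0 : 'rV[R]_n), cod (e + h).
Proof.
have := @near_cod R n G _ cod_e; rewrite (near_shift 0 e) subr0.
by apply: filterS => k; rewrite /= addrC.
Qed.

Lemma conj_u_cvg (g : G) : (g * u x * g^-1)%g @[x --> e] --> (1%g : G).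
Proof.
have h : (g * u x * g^-1)%g @[x --> e] --> (g * 1 * g^-1)%g.
  exact: (mulg_cvg _ (mulg_cvg _ (cvg_cst g) uncoord_cvg) (cvg_cst _)).
by rewrite mulg1 mulgV in h.
Qed.

Lemma conj_dom (g : G) : \forall x \near e, dom (g * u x * g^-1)%g.
Proof. exact: (conj_u_cvg g) (near_dom dom1). Qed.

Lemma conj_differentiable (g : G) : differentiable (conj_chart g) e.
Proof. by apply: translation_differentiable; rewrite mulgV; exact: dom1. Qed.

Lemma conj_e (g : G) : c (g * u e * g^-1)%g = e.
Proof. by rewrite uncoord_e mulg1 mulgV. Qed.

Lemma mulmx_Ad (g : G) v : v *m Ad g = 'd (conj_chart g) e v.
Proof. by rewrite /Ad /jacobian mul_rV_lin1. Qed.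

Lemma diff_conjM (g h : G) v :
  'd (conj_chart (g * h)%g) e v = 'd (conj_chart g) e ('d (conj_chart h) e v).
Proof.
have dg := @conj_differentiable g; have dh := @conj_differentiable h.
have E : \forall x \near e, (conj_chart g \o conj_chart h) x = conj_chart (g * h)%g x.
  have := conj_dom h; apply: filterS => x xd /=.
  by rewrite (chart_coordK xd) invgM !mulgA.
have [dgh dE] := diff_comp_at v dh (conj_e h) dg.
exact: (etrans (near_eq_diff v E dgh) dE).
Qed.

(** The order is reversed because matrices act on row vectors. *)
Lemma AdM (g h : G) : Ad (g * h)%g = Ad h *m Ad g.
Proof.
apply/row_matrixP => i; rewrite !rowE mulmxA; set v := delta_mx 0 i.
apply: (etrans (mulmx_Ad (g * h)%g v)); apply: (etrans (diff_conjM g h v)).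
symmetry; apply: (etrans (congr1 (mulmx ^~ (Ad g)) (mulmx_Ad h v))).
exact: mulmx_Ad.
Qed.

Lemma Ad1 : Ad (1%g : G) = 1%:M.
Proof.
apply/row_matrixP => i; rewrite !rowE mulmx1; set v := delta_mx 0 i.
apply: (etrans (mulmx_Ad 1%g v)).
have E : \forall x \near e, id x = conj_chart (1%g : G) x.
  have := @near_cod R n G _ cod_e; apply: filterS => x xc.
  by rewrite mul1g invg1 mulg1 chart_uncoordK.
apply: (etrans (near_eq_diff v E _)) => //.
by rewrite diff_val.
Qed.

Local Notation m := (fun p : 'rV[R]_n * 'rV[R]_n => c (u p.1 * u p.2)%g).

Lemma mul_chart_smooth : smooth_on [set p : 'rV[R]_n * 'rV[R]_n |
  [/\ cod p.1, cod p.2 & dom (u p.1 * u p.2)%g]] m.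
Proof. exact: (@lie_mul_smooth R n G 1%g 1%g 1%g). Qed.

Lemma mul_chart_differentiable x y : cod x -> cod y -> dom (u x * u y)%g ->
  differentiable m (x, y).
Proof. exact: (@mul_charts_differentiable R n G 1%g 1%g 1%g). Qed.

Lemma mul_chart_e_differentiable : differentiable m (e, e).
Proof.
apply: mul_chart_differentiable; rewrite ?uncoord_e ?mulg1.
- exact: cod_e.
- exact: cod_e.
- exact: dom1.
Qed.

(** The partial differentials of the multiplication at (e, x) and at (x, e):
    the differentials at the identity of the right and left translations by
    the point of coordinate x. *)
Definition dmul_left (x v : 'rV[R]_n) : 'rV[R]_n := 'd m (e, x) (v, 0).
Definition dmul_right (x v : 'rV[R]_n) : 'rV[R]_n := 'd m (x, e) (0, v).

Lemma dmul_rightE x v : cod x -> differentiable (fun y => m (x, y)) e /\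
  dmul_right x v = 'd (fun y => m (x, y)) e v.
Proof.
move=> xc.
have mxe : differentiable m (x, e).
  apply: mul_chart_differentiable; rewrite ?uncoord_e ?mulg1 //; first exact: cod_e.
  exact: chart_uncoord_dom.
have p : differentiable (fun y : 'rV[R]_n => (x, y)) e by [].
have [dm dE] := diff_comp_at v p erefl mxe; split=> //.
exact: (esym (etrans dE (congr1 ('d m (x, e)) (diff_pairr x e v)))).
Qed.

Lemma dmul_leftE x v : cod x -> differentiable (fun y => m (y, x)) e /\
  dmul_left x v = 'd (fun y => m (y, x)) e v.
Proof.
move=> xc.
have mxe : differentiable m (e, x).
  apply: mul_chart_differentiable; rewrite ?uncoord_e ?mul1g //; first exact: cod_e.
  exact: chart_uncoord_dom.
have p : differentiable (fun y : 'rV[R]_n => (y, x)) e by [].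
have [dm dE] := diff_comp_at v p erefl mxe; split=> //.
exact: (esym (etrans dE (congr1 ('d m (e, x)) (diff_pairl x e v)))).
Qed.

Lemma dmul_left_linear x : linear (dmul_left x).
Proof.
move=> a v w; rewrite /dmul_left -linearP; congr ('d m _ _).
by congr (_, _); rewrite /= scaler0 addr0.
Qed.

Lemma dmul_right_linear x : linear (dmul_right x).
Proof.
move=> a v w; rewrite /dmul_right -linearP; congr ('d m _ _).
by congr (_, _); rewrite /= scaler0 addr0.
Qed.

HB.instance Definition _ x :=
  GRing.isLinear.Build R 'rV[R]_n 'rV[R]_n _ (dmul_left x) (dmul_left_linear x).
HB.instance Definition _ x :=
  GRing.isLinear.Build R 'rV[R]_n 'rV[R]_n _ (dmul_right x) (dmul_right_linear x).

(** Differentiate (g y g^-1) g = g y at y = 1. This expresses [Ad] by the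
    differentials of the multiplication alone, which makes its dependence on g
    differentiable. *)
Lemma Ad_dmul x : cod x -> Ad (u x) *m lin1_mx (dmul_left x) = lin1_mx (dmul_right x).
Proof.
move=> xc; apply/row_matrixP => i; rewrite !rowE mulmxA; set v := delta_mx 0 i.
apply: (etrans (mul_rV_lin1 (dmul_left x) _)); symmetry.
apply: (etrans (mul_rV_lin1 (dmul_right x) _)); symmetry.
have [d1 E1] := dmul_leftE (v *m Ad (u x)) xc; have [d2 E2] := dmul_rightE v xc.
have [d3 E3] := diff_comp_at v (conj_differentiable (u x)) (conj_e (u x)) d1.
apply: (etrans E1); apply: (etrans (congr1 _ (mulmx_Ad (u x) v))).
apply: (etrans (esym E3)); symmetry; apply: (etrans E2); apply: near_eq_diff => //.
have := conj_dom (u x); apply: filterS => y yd /=.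
by rewrite (chart_coordK yd) mulgVK.
Qed.

Definition coAd_mx (g : G) : 'M[R]_n := Ad g^-1%g.

Lemma coAd_mxM (g h : G) : coAd_mx (g * h)%g = coAd_mx g *m coAd_mx h.
Proof. by rewrite /coAd_mx invgM AdM. Qed.

Lemma coAd_mx1 : coAd_mx 1%g = 1%:M.
Proof. by rewrite /coAd_mx invg1 Ad1. Qed.

Lemma coAd_dmul x : cod x -> coAd_mx (u x) *m lin1_mx (dmul_right x) = lin1_mx (dmul_left x).
Proof.
move=> xc; rewrite -Ad_dmul // mulmxA (_ : coAd_mx (u x) *m Ad (u x) = 1%:M) ?mul1mx //.
by rewrite -[X in _ *m Ad X]invgK -/(coAd_mx _) -coAd_mxM mulgV coAd_mx1.
Qed.

Lemma dmul_left_e v : dmul_left e v = v.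
Proof.
have [d E] := dmul_leftE v cod_e.
have E' : \forall y \near e, id y = m (y, e).
  have := @near_cod R n G _ cod_e; apply: filterS => y yc.
  by rewrite /= uncoord_e mulg1 chart_uncoordK.
have di : differentiable (id : 'rV[R]_n -> 'rV[R]_n) e by [].
have idE : 'd (id : 'rV[R]_n -> 'rV[R]_n) e v = v by rewrite diff_val.
exact: (etrans E (etrans (near_eq_diff v E' di) idE)).
Qed.

Lemma dmul_right_e v : dmul_right e v = v.
Proof.
have [d E] := dmul_rightE v cod_e.
have E' : \forall y \near e, id y = m (e, y).
  have := @near_cod R n G _ cod_e; apply: filterS => y yc.
  by rewrite /= uncoord_e mul1g chart_uncoordK.
have di : differentiable (id : 'rV[R]_n -> 'rV[R]_n) e by [].
have idE : 'd (id : 'rV[R]_n -> 'rV[R]_n) e v = v by rewrite diff_val.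
exact: (etrans E (etrans (near_eq_diff v E' di) idE)).
Qed.

Lemma dmul_left_differentiable v : differentiable (fun x => dmul_left x v) e.
Proof.
have mee : [set p : 'rV[R]_n * 'rV[R]_n |
  [/\ cod p.1, cod p.2 & dom (u p.1 * u p.2)%g]] (e, e).
  by split; rewrite /= ?uncoord_e ?mulg1; [exact: cod_e|exact: cod_e|exact: dom1].
have p : differentiable (fun y : 'rV[R]_n => (e, y)) e by [].
exact: (differentiable_comp p (smooth_diff_differentiable (v, 0) mul_chart_smooth mee)).
Qed.

Lemma dmul_right_differentiable v : differentiable (fun x => dmul_right x v) e.
Proof.
have mee : [set p : 'rV[R]_n * 'rV[R]_n |
  [/\ cod p.1, cod p.2 & dom (u p.1 * u p.2)%g]] (e, e).
  by split; rewrite /= ?uncoord_e ?mulg1; [exact: cod_e|exact: cod_e|exact: dom1].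
have p : differentiable (fun y : 'rV[R]_n => (y, e)) e by [].
exact: (differentiable_comp p (smooth_diff_differentiable (0, v) mul_chart_smooth mee)).
Qed.
End AdjointAction.

Section Expansion.
Context {R : realType} {n : nat} {G : lieGroupType R n}.
Local Notation c := (chart_coord (@chart1 R n G)).
Local Notation u := (chart_uncoord (@chart1 R n G)).
Local Notation cod := (chart_cod (@chart1 R n G)).
Local Notation e := (c 1%g).

(** By [coAd_dmul] the matrix of [coAd] is the quotient of two matrices that
    depend differentiably on the point and equal 1 at the identity. The map A
    is, up to sign and transposition, the adjoint representation of the Lie
    algebra. *)
Lemma coAd_expansion : exists A : {linear 'rV[R]_n -> 'M[R]_n}, forall eps, 0 < eps ->
  \forall h \near (0 : 'rV[R]_n), `|coAd_mx (u (e + h) : G) - 1%:M - A h| <= eps * `|h|.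
Proof.
have J1e : lin1_mx (@dmul_left R n G e) = 1%:M.
  by apply/row_matrixP => i; rewrite !rowE mulmx1 mul_rV_lin1 /= dmul_left_e.
have J2e : lin1_mx (@dmul_right R n G e) = 1%:M.
  by apply/row_matrixP => i; rewrite !rowE mulmx1 mul_rV_lin1 /= dmul_right_e.
have [P HP] := lin1_mx_expansion J1e (@dmul_left_differentiable R n G).
have [B HB] := lin1_mx_expansion J2e (@dmul_right_differentiable R n G).
pose A h := P h - B h.
have A_lin : linear A.
  by move=> a v w; rewrite /A (linearP P) (linearP B) scalerBr opprD addrACA.
pose A' : {linear 'rV[R]_n -> 'M[R]_n} := HB.pack A (GRing.isLinear.Build R _ _ _ A A_lin).
exists A' => eps eps0; rewrite /= /A.
have [CP CP0 hP] := linear_rV_bounded P.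
have [CB CB0 hB] := linear_rV_bounded B.
pose C := CP + CB + 1.
have C1 : 1 <= C by rewrite /C; lra.
have C0 : 0 < C := lt_le_trans ltr01 C1.
have codh := @near_cod_e R n G.
have N1 : 0 < 2 * (n%:R * C + 1) by rewrite mulr_gt0 // ltr_wpDl // mulr_ge0 // ltW.
have N2 : 0 < 8 * (n%:R * C * C + 1).
  by rewrite mulr_gt0 // ltr_wpDl // !mulr_ge0 // ltW.
have small1 : \forall h \near (0 : 'rV[R]_n), `|h| < 1 / (2 * (n%:R * C + 1)).
  by apply: nbhs0_lt; rewrite divr_gt0.
have small2 : \forall h \near (0 : 'rV[R]_n), `|h| < eps / (8 * (n%:R * C * C + 1)).
  by apply: nbhs0_lt; rewrite divr_gt0.
have rho0 : 0 < Num.min 1 (eps / 4) by rewrite lt_min ltr01 divr_gt0.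
have nearP := HP _ rho0; have nearB := HB _ rho0.
near=> h.
have hc : cod (e + h) by near: h.
have h1 : `|lin1_mx (@dmul_left R n G (e + h)) - 1%:M - P h| <= Num.min 1 (eps / 4) * `|h|.
  by near: h.
have h2 : `|lin1_mx (@dmul_right R n G (e + h)) - 1%:M - B h| <= Num.min 1 (eps / 4) * `|h|.
  by near: h.
have rho1 : Num.min 1 (eps / 4) <= 1 by rewrite ge_min lexx.
have rhoe : Num.min 1 (eps / 4) <= eps / 4 by rewrite ge_min lexx orbT.
apply: (quotient_first_order (C := C) (coAd_dmul hc)) => //.
- by apply: (le_trans h1); rewrite ler_wpM2r.
- by apply: (le_trans h2); rewrite ler_wpM2r.
- rewrite -(subrK (P h) (_ - 1%:M)); apply: (le_trans (ler_normD _ _)).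
  apply: (le_trans (lerD h1 (hP h))); rewrite -mulrDl ler_wpM2r // addrC lerD //.
  by rewrite lerDl ltW.
- rewrite -(subrK (B h) (_ - 1%:M)); apply: (le_trans (ler_normD _ _)).
  apply: (le_trans (lerD h2 (hB h))); rewrite -mulrDl ler_wpM2r // addrC lerD //.
  by rewrite lerDr ltW.
- by rewrite -ler_pdivlMr //; apply: ltW; near: h.
- by rewrite -ler_pdivlMr //; apply: ltW; near: h.
Unshelve. all: by end_near. Qed.
End Expansion.

(** * One-parameter subgroups and the exponential map *)

Section OneParameterSubgroups.
Context {R : realType} {n : nat} {G : lieGroupType R n}.
Local Notation c := (chart_coord (@chart1 R n G)).
Local Notation u := (chart_uncoord (@chart1 R n G)).
Local Notation dom := (chart_dom (@chart1 R n G)).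
Local Notation e := (c 1%g).
Local Notation m := (fun p : 'rV[R]_n * 'rV[R]_n => c (u p.1 * u p.2)%g).

(** Only differentiability at 0 is asked for: it determines the curve
    ([hom_unique]), and it is plainly inherited by the conjugates of a curve
    ([hom_conj]). *)
Record hom_with_velocity (gamma : R -> G) (v : 'rV[R]_n) : Prop := HomWithVelocity {
  hom_morph : {morph gamma : s t / s + t >-> (s * t)%g};
  hom_cvg : gamma t @[t --> 0] --> (1%g : G);
  hom_differentiable : differentiable (c \o gamma) 0;
  hom_velocity : 'd (c \o gamma) 0 1 = v
}.

Lemma hom0 (gamma : R -> G) : {morph gamma : s t / s + t >-> (s * t)%g} -> gamma 0 = 1%g :> G.
Proof. by move=> h; apply: (@mulgI _ (gamma 0)); rewrite -h addr0 mulg1. Qed.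

Lemma homN (gamma : R -> G) t : {morph gamma : s t / s + t >-> (s * t)%g} ->
  gamma (- t) = (gamma t)^-1%g :> G.
Proof. by move=> h; apply: (@mulgI _ (gamma t)); rewrite -h subrr mulgV hom0. Qed.

Lemma hom_natmul (gamma : R -> G) t k : {morph gamma : s t / s + t >-> (s * t)%g} ->
  gamma (k%:R * t) = (gamma t ^+ k)%g :> G.
Proof.
move=> h; elim: k => [|k IH]; first by rewrite mul0r hom0 // expg0.
by rewrite -natr1 mulrDl mul1r h IH expgSr.
Qed.

Lemma one_parameter_hom (gamma : R -> G) v : one_parameter_subgroup gamma ->
  derive1 (c \o gamma) 0 = v -> hom_with_velocity gamma v.
Proof.
move=> [[cont sm] hom] vE.
have g0 := hom0 hom.
have d : differentiable (c \o gamma) 0.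
  by apply: (smooth_differentiable (sm 1%g)); rewrite /= g0; exact: dom1.
split=> //; first by rewrite -g0; exact: cont.
by rewrite -derive1E'.
Qed.

Lemma diff_mul_chart_e v w : 'd m (e, e) (v, w) = v + w.
Proof.
have -> : (v, w) = (v, 0) + (0, w) :> 'rV[R]_n * 'rV[R]_n.
  by congr (_, _); rewrite /= ?addr0 ?add0r.
rewrite linearD; congr (_ + _); [exact: dmul_left_e|exact: dmul_right_e].
Qed.

(** The curve p t = gamma1 (- t) gamma2 t has derivative 0 at 0 and, by
    translation, at every small t. So it is constant near 0, and the two
    morphisms agree near 0, hence everywhere. *)
Lemma hom_unique gamma1 gamma2 v : hom_with_velocity gamma1 v ->
  hom_with_velocity gamma2 v -> gamma1 =1 gamma2.
Proof.
move=> [h1 c1 d1 v1] [h2 c2 d2 v2].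
have oppc : - t @[t --> (0 : R)] --> (0 : R) by rewrite -{2}oppr0; exact: cvgN.
have c1N : gamma1 (- t) @[t --> 0] --> (1%g : G) by apply: (cvg_comp _ _ oppc c1).
pose p t := (gamma1 (- t) * gamma2 t)%g.
have p0 : p 0 = 1%g by rewrite /p oppr0 (hom0 h1) (hom0 h2) mulg1.
have pc : p t @[t --> 0] --> (1%g : G).
  have := mulg_cvg _ c1N c2; rewrite mulg1; exact.
have dN : differentiable (fun t => c (gamma1 (- t))) 0 /\
    'd (fun t => c (gamma1 (- t))) 0 1 = - v.
  have ii : is_diff (0 : R) (fun t : R => - t) (fun t : R => - t).
    exact: (is_diffN (is_diff_id (0 : R))).
  have [dd E] := diff_comp_at (1 : R) (@ex_diff _ _ _ _ _ _ _ ii) (oppr0 R) d1.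
  split; first exact: dd.
  apply: (etrans E); rewrite -v1 -linearN.
  exact: (congr1 ('d (c \o gamma1) 0) (congr1 (fun f => f 1) (@diff_val _ _ _ _ _ _ _ ii))).
have [dq dq0] : differentiable (c \o p) 0 /\ 'd (c \o p) 0 1 = 0.
  case: dN => dN dNE.
  pose pr t := (c (gamma1 (- t)), c (gamma2 t)).
  have dpr : differentiable pr 0 by exact: differentiable_pair.
  have pr0 : pr 0 = (e, e) by rewrite /pr oppr0 (hom0 h1) (hom0 h2).
  have prE : 'd pr 0 1 = (- v, v).
    apply: (etrans (congr1 (fun f => f 1) (diff_pair dN d2))).
    by congr (_, _).
  have [dmp dmpE] := diff_comp_at (1 : R) dpr pr0 (@mul_chart_e_differentiable R n G).
  have E : \forall t \near (0 : R), (m \o pr) t = (c \o p) t.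
    have k1 := c1N _ (near_dom dom1); have k2 := c2 _ (near_dom dom1).
    near=> t; have k1' : dom (gamma1 (- t)) by near: t.
    have k2' : dom (gamma2 t) by near: t.
    by rewrite /= (chart_coordK k1') (chart_coordK k2').
  split; first exact: (near_eq_is_diff E dmp).1.
  apply: (etrans (near_eq_diff (1 : R) E dmp)); apply: (etrans dmpE).
  by rewrite prE; apply: (etrans (diff_mul_chart_e _ _)); rewrite addNr.
have [r /= r0 pr] : exists2 r, 0 < r & forall t, `|t| < r -> dom (p t).
  have /nbhs_ballP[r /= r0 rp] := pc _ (near_dom dom1).
  by exists r => // t tr; apply: rp; rewrite /ball /= sub0r normrN.
(* p (t + s) = gamma1 (- t) * p s * gamma2 t *)
have local t : `|t| < r -> differentiable (c \o p) t /\ 'd (c \o p) t 1 = 0.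
  move=> tr; set a := gamma1 (- t); set b := gamma2 t.
  have dC : differentiable (fun y => c (a * u y * b)%g) e.
    by apply: translation_differentiable; exact: pr.
  have [dCq dCqE] := diff_comp_at (1 : R) dq (congr1 c p0) dC.
  have E : \forall s \near (0 : R), ((fun y => c (a * u y * b)%g) \o (c \o p)) s =
      (c \o p) (t + s).
    have pd : \forall s \near (0 : R), dom (p s) by exact: pc _ (near_dom dom1).
    apply: filterS pd => s ps.
    rewrite /= (chart_coordK ps) /p opprD h1 (addrC t s) h2 !mulgA.
    by congr (c (_ * _))%g; rewrite -/a -h1 addrC h1 mulgA.
  have [ds dsE] := is_diff_shift (1 : R) (near_eq_is_diff E dCq).1.
  split; first exact: ds.
  have z0 : 'd (fun y => c (a * u y * b)%g) e 0 = 0 by exact: linear0.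
  exact: (etrans dsE (etrans (near_eq_diff (1 : R) E dCq)
    (etrans dCqE (etrans (congr1 ('d (fun y => c (a * u y * b)%g) e) dq0) z0)))).
have near1 t : `|t| < r -> gamma1 t = gamma2 t.
  move=> tr; have := constant_of_diff_eq0 local tr; rewrite /= p0 => E.
  have := chart_coordK (pr _ tr); rewrite E uncoord_e /p homN // => E'.
  by rewrite -(mulg1_eq (esym E')) invgK.
(* t / k.+1 lies in the window, and morphisms commute with multiples *)
move=> t; pose k := Num.bound (`|t| / r).
have k0 : (0 < k.+1%:R :> R) by [].
have tk : `|t / k.+1%:R| < r.
  rewrite normrM normfV normr_nat ltr_pdivrMr // mulrC -ltr_pdivrMr //.
  rewrite (lt_le_trans (archi_boundP _)) ?divr_ge0 ?(ltW r0) //.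
  by rewrite ler_nat leqW.
have -> : t = k.+1%:R * (t / k.+1%:R) by rewrite mulrC divfK // gt_eqF.
by rewrite !hom_natmul // near1.
Unshelve. all: by end_near. Qed.
End OneParameterSubgroups.

Section Exponential.
Context {R : realType} {n : nat} {G : lieGroupType R n}.
Local Notation c := (chart_coord (@chart1 R n G)).
Local Notation u := (chart_uncoord (@chart1 R n G)).
Local Notation dom := (chart_dom (@chart1 R n G)).
Local Notation e := (c 1%g).

Lemma one_parameter_scale (gamma : R -> G) (a : R) : one_parameter_subgroup gamma ->
  one_parameter_subgroup (fun t => gamma (t * a)).
Proof.
move=> [[cont sm] hom]; split; last by move=> s t; rewrite mulrDl hom.
split.
  move=> t; apply: (cvg_comp (fun t : R => t * a) gamma _ (cont _)).
  exact: mulrr_continuous.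
move=> b k; apply: (Ck_scale a _ (sm b k)).
by apply: open_comp => [t _|]; [exact: cont|exact: chart_dom_open].
Qed.

Lemma hom_scale (gamma : R -> G) (a : R) v : hom_with_velocity gamma v ->
  hom_with_velocity (fun t => gamma (t * a)) (a *: v).
Proof.
move=> [hom gc gd gv].
have ac : t * a @[t --> (0 : R)] --> (0 : R).
  by rewrite -{2}(mul0r a); exact: mulrr_continuous.
have sd : is_diff (0 : R) (fun t : R => t * a) (fun t : R => t * a).
  exact: (is_diff_scalel (0 : R) a).
have [d E] := diff_comp_at (1 : R) (@ex_diff _ _ _ _ _ _ _ sd) (mul0r a) gd.
split.
- by move=> s t; rewrite mulrDl hom.
- exact: (cvg_comp _ _ ac gc).
- exact: d.
- apply: (etrans E); apply: (etrans (congr1 ('d (c \o gamma) 0)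
    (congr1 (fun f => f 1) (@diff_val _ _ _ _ _ _ _ sd)))).
  have h (w : R) : 'd (c \o gamma) 0 (a *: w) = a *: 'd (c \o gamma) 0 w by exact: linearZ.
  rewrite -gv; apply: etrans (h 1); congr ('d _ _ _).
  by rewrite mul1r [RHS]mulr1.
Qed.

Lemma hom_derive1 (gamma : R -> G) v : hom_with_velocity gamma v ->
  derive1 (c \o gamma) 0 = v.
Proof. by move=> [_ _ d <-]; rewrite derive1E'. Qed.

(** By uniqueness the choice made in the definition of the exponential map is
    immaterial. *)
Lemma lie_exp_eq (gamma : R -> G) v : one_parameter_subgroup gamma ->
  hom_with_velocity gamma v -> lie_exp v = gamma 1.
Proof.
move=> og hv; rewrite /lie_exp; case: xgetP => [g _ [delta /= [od dv] <-]|].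
  exact: (hom_unique (one_parameter_hom od dv) hv).
by move=> /(_ (gamma 1))[]; exists gamma => //; split => //; exact: hom_derive1.
Qed.

Lemma one_parameter_cst : one_parameter_subgroup (fun=> 1%g : G).
Proof.
split; last by move=> s t; rewrite mulg1.
by split; [exact: cst_continuous|move=> a k; exact: Ck_cst].
Qed.

(** Injectivity of the exponential map yields existence: without a
    one-parameter subgroup of velocity v there is none of velocity 2 v either,
    so both vectors have the default value 1 as exponential, whence v = 2 v =
    0; but the constant curve has velocity 0. *)
Lemma one_parameter_exists v : exponential G ->
  exists2 gamma : R -> G, one_parameter_subgroup gamma & hom_with_velocity gamma v.
Proof.
move=> /bij_inj exp_inj; apply: contrapT => no.
have no2 : ~ exists2 gamma : R -> G,
    one_parameter_subgroup gamma & hom_with_velocity gamma (2 *: v).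
  move=> [gamma og hg]; apply: no; exists (fun t => gamma (t * 2^-1)).
    exact: one_parameter_scale.
  have := hom_scale 2^-1 hg; rewrite scalerA mulVf ?scale1r // pnatr_eq0.
have exp1 w : ~ (exists2 gamma : R -> G,
      one_parameter_subgroup gamma & hom_with_velocity gamma w) ->
    lie_exp w = 1%g :> G.
  move=> now; rewrite /lie_exp xgetPN // => g [gamma /= [og gv] _].
  by apply: now; exists gamma => //; exact: one_parameter_hom.
have /exp_inj v0 : lie_exp v = lie_exp (2 *: v) :> G by rewrite !exp1.
have v00 : v = 0.
  by apply: (addrI v); rewrite addr0 [RHS]v0 scaler_nat mulr2n.
apply: no; exists (fun=> 1%g); first exact: one_parameter_cst.
have E : derive1 (c \o (fun=> 1%g : G)) 0 = v :> 'rV[R]_n.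
  by rewrite v00 (_ : _ \o _ = cst e) // derive1_cst.
exact: one_parameter_hom one_parameter_cst E.
Qed.

Hypothesis G_exp : exponential G.

Lemma lie_exp_double v : lie_exp (2 *: v) = (lie_exp v * lie_exp v)%g :> G.
Proof.
have [gamma og hg] := one_parameter_exists v G_exp.
rewrite (lie_exp_eq og hg) (lie_exp_eq (one_parameter_scale 2 og) (hom_scale 2 hg)).
by rewrite mul1r -(hom_morph hg).
Qed.

Lemma hom_conj (gamma : R -> G) g v : hom_with_velocity gamma v ->
  hom_with_velocity (fun t => (g * gamma t * g^-1)%g) (v *m Ad g).
Proof.
move=> [hom gc gd gv].
have [d E] := diff_comp_at (1 : R) gd (congr1 c (hom0 hom)) (conj_differentiable g).
have gdom : \forall t \near (0 : R), dom (gamma t) by exact: gc _ (near_dom dom1).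
have EE : \forall t \near (0 : R), ((fun x => c (g * u x * g^-1)%g) \o (c \o gamma)) t =
    (c \o (fun t => (g * gamma t * g^-1)%g)) t.
  by apply: filterS gdom => t dt; rewrite /= (chart_coordK dt).
split.
- by move=> s t; rewrite hom !mulgA mulgVK.
- have := mulg_cvg _ (mulg_cvg _ (cvg_cst g) gc) (cvg_cst g^-1%g).
  by rewrite mulg1 mulgV; exact.
- exact: (near_eq_is_diff EE d).1.
- apply: (etrans (near_eq_diff (1 : R) EE d)); apply: (etrans E).
  apply: (etrans (congr1 _ gv)); exact: (esym (mulmx_Ad g v)).
Qed.

Lemma lie_exp_conj g v : lie_exp (v *m Ad g) = (g * lie_exp v * g^-1)%g :> G.
Proof.
have [gamma og hg] := one_parameter_exists v G_exp.
have [delta od hd] := one_parameter_exists (v *m Ad g) G_exp.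
by rewrite (lie_exp_eq og hg) (lie_exp_eq od hd) (hom_unique hd (hom_conj g hg)).
Qed.

Lemma square_inj (g h : G) : (g * g = h * h)%g -> g = h.
Proof.
have [lg _ lgK] := G_exp; rewrite -(lgK g) -(lgK h) -!lie_exp_double.
move=> /(bij_inj G_exp) E; congr lie_exp.
by apply: (scalerI _ E); rewrite pnatr_eq0.
Qed.

(** The element h = exp v is fixed by conjugation by g^2, so g and h g h^-1
    have the same square. *)
Lemma Ad_fixed_square (g : G) (v : 'rV[R]_n) : v *m Ad g *m Ad g = v -> v *m Ad g = v.
Proof.
move=> E; set h := lie_exp v : G.
have c2 : (g * (g * h * g^-1) * g^-1 = h)%g by rewrite -!lie_exp_conj E.
have comm : (g * g * h = h * (g * g))%g by rewrite -{2}c2 !mulgA !mulgVK.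
have c2' : ((h * g * h^-1) * (h * g * h^-1) = g * g)%g.
  by rewrite !mulgA mulgVK -(mulgA h) -comm mulgK.
have hg := square_inj c2'.
by apply: (bij_inj G_exp); rewrite lie_exp_conj -/h -{1}hg mulgVK mulgK.
Qed.

(** Let M be the matrix of [coAd g]. An eigenvector of M for -1 is fixed by
    M^2, hence by M, so it vanishes. Thus 1 + M is invertible, and it kills
    [xi]. *)
Lemma coAd_opp_eq0 (g : G) (xi : 'cV[R]_n) : coAd g xi = - xi -> xi = 0.
Proof.
rewrite /coAd; set M := Ad _ => E.
have inj (v : 'rV[R]_n) : v *m (1%:M + M) = 0 -> v = 0.
  rewrite mulmxDr mulmx1 => /eqP; rewrite addrC addr_eq0 => /eqP vM.
  have : v *m M = v by apply: Ad_fixed_square; rewrite vM mulNmx vM opprK.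
  rewrite vM => /eqP; rewrite -subr_eq0 -opprD oppr_eq0 -mulr2n -scaler_nat.
  by rewrite scaler_eq0 pnatr_eq0 /= => /eqP.
have uM : 1%:M + M \in unitmx by exact: unitmx_inj.
by rewrite -[xi](mulKmx uM) mulmxDl mul1mx E addrN mulmx0.
Qed.
End Exponential.

(** * The coadjoint action *)

Section CoadjointAction.
Context {R : realType} {n : nat} {G : lieGroupType R n}.
Local Notation c := (chart_coord (@chart1 R n G)).
Local Notation u := (chart_uncoord (@chart1 R n G)).
Local Notation dom := (chart_dom (@chart1 R n G)).
Local Notation e := (c 1%g).

Lemma coAdM (g h : G) xi : coAd (g * h)%g xi = coAd g (coAd h xi).
Proof. by rewrite /coAd -!/(coAd_mx _) coAd_mxM mulmxA. Qed.

Lemma coAd1 xi : coAd (1%g : G) xi = xi.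
Proof. by rewrite /coAd -/(coAd_mx _) coAd_mx1 mul1mx. Qed.

Lemma coAdK (g : G) xi : coAd g^-1%g (coAd g xi) = xi.
Proof. by rewrite -coAdM mulVg coAd1. Qed.

Lemma coAd_continuous_vec (g : G) : continuous (coAd g : 'cV[R]_n -> 'cV[R]_n).
Proof. move=> xi; exact: (@mulmx_cvgr R n n 1 (coAd_mx g) xi _ (nbhs xi) id _ cvg_id). Qed.

Lemma coAd_mx_cvg1 : coAd_mx g @[g --> (1%g : G)] --> (1%:M : 'M[R]_n).
Proof.
have [A HA] := @coAd_expansion R n G.
have [C C0 hC] := linear_rV_bounded A.
apply/cvgrPdist_le => eps e0.
have h1 := HA 1 ltr01.
have cu : \forall g \near (1%g : G), dom g by exact: near_dom dom1.
have cc : \forall g \near (1%g : G), `|coAd_mx (u (e + (c g - e)) : G) - 1%:M - A (c g - e)|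
    <= 1 * `|c g - e|.
  have ce : (c g - e) @[g --> (1%g : G)] --> e - e.
    by apply: cvgB; [exact: coord_cvg|exact: cvg_cst].
  rewrite subrr in ce.
  exact: ce h1.
have cs : \forall g \near (1%g : G), `|c g - e| <= eps / (C + 1).
  have := @coord_cvg R n G; move/cvgrPdist_le => /(_ (eps / (C + 1))).
  rewrite divr_gt0 ?addr_gt0 // => /(_ isT); apply: filterS => g.
  by rewrite distrC.
near=> g.
have gd : dom g by near: g.
have h2 : `|c g - e| <= eps / (C + 1) by near: g.
have : `|coAd_mx (u (e + (c g - e)) : G) - 1%:M - A (c g - e)| <= 1 * `|c g - e| by near: g.
rewrite (addrC e (c g - e)) subrK (chart_coordK gd) mul1r => h3; rewrite distrC.
rewrite -(subrK (A (c g - e)) (coAd_mx g - 1%:M)).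
apply: (le_trans (ler_normD _ _)); apply: (le_trans (lerD h3 (hC _))).
rewrite -{1}[ `|c g - e| ]mul1r -mulrDl addrC.
by rewrite mulrC -ler_pdivlMr // addr_gt0.
Unshelve. all: by end_near. Qed.

Lemma coAd_continuous_grp xi : continuous (fun g : G => coAd g xi).
Proof.
move=> g.
have h1 : (g^-1 * h)%g @[h --> g] --> (g^-1 * g)%g.
  by apply: (@mulg_cvg R n G _ (nbhs g) (fun=> g^-1%g) id); [exact: cvg_cst|exact: cvg_id].
rewrite mulVg in h1.
have h2 := mulmx_cvgl (N := xi) _ (cvg_comp _ _ h1 coAd_mx_cvg1).
have h3 := mulmx_cvgr (M := coAd_mx g) _ (h2 _).
have E : (fun h : G => coAd h xi) = (fun h => coAd_mx g *m (coAd_mx (g^-1 * h)%g *m xi)).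
  by apply/funext => h; rewrite mulmxA -coAd_mxM mulgA mulgV mul1g.
have K : (fun h : G => coAd h xi) @ g --> coAd_mx g *m (1%:M *m xi).
  by rewrite E; exact: h3.
by rewrite mul1mx in K.
Qed.

Lemma orbit_refl xi : coadjoint_orbit (G := G) xi xi.
Proof. by exists 1%g => //; exact: coAd1. Qed.

Lemma orbit_eq xi eta : coadjoint_orbit (G := G) xi eta ->
  coadjoint_orbit (G := G) eta = coadjoint_orbit (G := G) xi.
Proof.
move=> [g _ <-]; apply/seteqP; split => _ [h _ <-].
  by exists (h * g)%g => //; rewrite coAdM.
by exists (h * g^-1)%g => //; rewrite coAdM coAdK.
Qed.
End CoadjointAction.

(** * Points of full rank are interior to their orbit *)

(** If the minimum of the distance to the target were attained at h with |h| =
    r, the lower bound k and the expansion of the orbit map would contradict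
    each other. Here a = |A h xi|, f is the distance to the target from the
    point given by h, and d the one from [xi]. *)
Lemma boundary_too_far (R : realFieldType) (k r a f d : R) :
  k * r <= a -> a <= f + d + k / 2 * r -> f < k * r / 4 -> d < k * r / 4 -> False.
Proof. lra. Qed.

Section OrbitDirections.
Context {R : realType} {n : nat} {G : lieGroupType R n}.
Local Notation c := (chart_coord (@chart1 R n G)).
Local Notation u := (chart_uncoord (@chart1 R n G)).
Local Notation dom := (chart_dom (@chart1 R n G)).
Local Notation cod := (chart_cod (@chart1 R n G)).
Local Notation e := (c 1%g).
Variable A : {linear 'rV[R]_n -> 'M[R]_n}.
Hypothesis A_expansion : forall eps, 0 < eps ->
  \forall h \near (0 : 'rV[R]_n), `|coAd_mx (u (e + h) : G) - 1%:M - A h| <= eps * `|h|.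

(** The velocity at [xi] of the orbit in the direction z, as a row vector so
    that [tangent_mx] can represent it. *)
Definition tangent (xi : 'cV[R]_n) (z : 'rV[R]_n) : 'rV[R]_n := (A z *m xi)^T.

Lemma tangent_linear xi : linear (tangent xi).
Proof. by move=> a v w; rewrite /tangent linearP mulmxDl -scalemxAl !linearD !linearZ. Qed.

HB.instance Definition _ xi :=
  GRing.isLinear.Build R 'rV[R]_n 'rV[R]_n _ (tangent xi) (tangent_linear xi).

Definition tangent_mx xi : 'M[R]_n := lin1_mx (tangent xi).

Lemma mul_tangent_mx z xi : z *m tangent_mx xi = (A z *m xi)^T.
Proof. exact: mul_rV_lin1. Qed.

Lemma tangent_mxE xi : tangent_mx xi =
  \matrix_(i, j) \sum_k A (delta_mx 0 i) j k * xi k 0.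
Proof. by apply/matrixP => i j; rewrite !mxE. Qed.

Lemma orbit_expansion xi eps : 0 < eps -> exists2 r : R, 0 < r & forall h, `|h| <= r ->
  cod (e + h) /\ `|coAd (u (e + h) : G) xi - xi - A h *m xi| <= eps * `|h|.
Proof.
move=> e0; apply: near0_norm_le.
have d0 : 0 < eps / (n%:R * `|xi| + 1) by rewrite divr_gt0 // ltr_wpDl.
have h1 := @near_cod_e R n G; have h2 := A_expansion d0.
near=> h; split; first by near: h.
have : `|coAd_mx (u (e + h) : G) - 1%:M - A h| <= eps / (n%:R * `|xi| + 1) * `|h| by near: h.
move=> h3; rewrite -[coAd _ _]/(coAd_mx _ *m xi) -{2}[xi]mul1mx -!mulmxBl.
apply: (le_trans (mulmx_norm_le _ _)); rewrite mulrAC.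
apply: (le_trans (ler_wpM2l _ h3)); first by rewrite mulr_ge0.
rewrite mulrA ler_wpM2r // mulrCA ger_pMr // ler_pdivrMr ?ltr_wpDl // mul1r lerDl //.
Unshelve. all: by end_near. Qed.

Lemma tangent_lower_bound xi : tangent_mx xi \in unitmx ->
  exists2 k, 0 < k & forall z, k * `|z| <= `|A z *m xi|.
Proof.
move=> uM; pose N := n%:R * `|invmx (tangent_mx xi)| + 1.
have N0 : 0 < N by rewrite ltr_wpDl // mulr_ge0.
exists N^-1; first by rewrite invr_gt0.
move=> z; rewrite ler_pdivrMl // -mx_norm_tr -mul_tangent_mx.
rewrite -{1}[z](mulmxK uM); apply: (le_trans (mulmx_norm_le _ _)).
by rewrite mulrAC ler_wpM2r // lerDl.
Qed.

(** The lower bound [k * |z|] survives a perturbation of [xi] that changes the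
    values by at most [k / 2 * |z|]. *)
Lemma tangent_unit_near xi : tangent_mx xi \in unitmx ->
  exists2 r : R, 0 < r & forall eta, `|eta - xi| <= r -> tangent_mx eta \in unitmx.
Proof.
move=> /tangent_lower_bound[k k0 kP]; have [C C0 CP] := linear_rV_bounded A.
have nC0 : 0 < n%:R * C + 1 by rewrite ltr_wpDl // mulr_ge0 // ltW.
exists (k / (2 * (n%:R * C + 1))); first by rewrite divr_gt0 // mulr_gt0.
move=> eta h; apply: unitmx_inj => z; rewrite mul_tangent_mx => /(congr1 trmx).
rewrite trmxK trmx0 => Az; apply/eqP; rewrite -normr_eq0.
have h1 : k * `|z| <= n%:R * (C * `|z|) * `|eta - xi|.
  apply: (le_trans (kP z)).
  have -> : A z *m xi = - (A z *m (eta - xi)) by rewrite mulmxBr Az sub0r opprK.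
  rewrite normrN; apply: (le_trans (mulmx_norm_le _ _)).
  by rewrite ler_wpM2r // ler_wpM2l.
have h2 : n%:R * (C * `|z|) * `|eta - xi| <= (k / 2) * `|z|.
  have : `|eta - xi| * (2 * (n%:R * C + 1)) <= k by rewrite -ler_pdivlMr // mulr_gt0.
  have z0 := normr_ge0 z; have d0 := normr_ge0 (eta - xi).
  move=> h3.
  have -> : n%:R * (C * `|z|) * `|eta - xi| = (n%:R * C * `|eta - xi|) * `|z| by ring.
  by rewrite ler_wpM2r //; nra.
have : k * `|z| <= k / 2 * `|z| by exact: le_trans h1 h2.
rewrite eq_le normr_ge0 andbT; have z0 := normr_ge0 z; nra.
Qed.

Lemma orbit_chart_continuous xi h : cod (e + h) ->
  {for h, continuous (fun h => coAd (u (e + h) : G) xi)}.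
Proof.
move=> ch.
have h1 : (e + k) @[k --> h] --> e + h.
  exact: (@cvgD _ _ _ (nbhs h) _ (fun=> e) id e h (cvg_cst e) cvg_id).
have h2 : u x @[x --> e + h] --> u (e + h) := chart_uncoord_continuous ch.
have h3 : coAd g xi @[g --> u (e + h)] --> coAd (u (e + h) : G) xi.
  exact: coAd_continuous_grp.
exact: (cvg_comp _ _ (cvg_comp _ _ h1 h2) h3).
Qed.

(** Invertibility at the point x0 provides a direction z whose velocity is
    exactly the difference w from x0 to the target. Moving by a small multiple
    t of z multiplies the distance by about 1 - t. *)
Lemma orbit_closer xi eta h0 r : tangent_mx (coAd (u (e + h0) : G) xi) \in unitmx ->
  cod (e + h0) -> `|h0| < r -> coAd (u (e + h0) : G) xi != eta ->
  exists h, [/\ `|h| <= r, cod (e + h) &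
    `|coAd (u (e + h) : G) xi - eta| < `|coAd (u (e + h0) : G) xi - eta|].
Proof.
set x0 := coAd _ xi => uM ch h0r ne.
pose w := eta - x0; pose z := w^T *m invmx (tangent_mx x0).
have Az : A z *m x0 = w.
  by apply: trmx_inj; rewrite -mul_tangent_mx mulmxKV.
have w0 : 0 < `|w| by rewrite normr_gt0 subr_eq0 eq_sym.
have e20 : 0 < `|w| / (2 * (`|z| + 1)) by rewrite divr_gt0 // mulr_gt0 // ltr_wpDl.
have [r2 r20 exp2] := orbit_expansion x0 e20.
pose g t := (u (e + t *: z) * u (e + h0))%g : G.
have tz : t *: z @[t --> (0 : R)] --> (0 : 'rV[R]_n).
  by rewrite -[X in _ --> X](scale0r z); apply: cvgZr_tmp.
have tz' : (e + t *: z) @[t --> (0 : R)] --> e + 0 by apply: cvgD => //; exact: cvg_cst.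
rewrite addr0 in tz'.
have gc : g t @[t --> (0 : R)] --> (1 * u (e + h0) : G)%g.
  by apply: mulg_cvg; [exact: (cvg_comp _ _ tz' uncoord_cvg)|exact: cvg_cst].
rewrite mul1g in gc.
have dh0 : dom (u (e + h0)) by exact: chart_uncoord_dom.
have gdom : \forall t \near (0 : R), dom (g t) by exact: gc _ (near_dom dh0).
have cg : c (g t) @[t --> (0 : R)] --> e + h0.
  by have := cvg_comp _ _ gc (chart_coord_continuous dh0); rewrite (chart_uncoordK ch).
have hr : \forall t \near (0 : R), `|c (g t) - e| <= r.
  have : (c (g t) - e) @[t --> (0 : R)] --> e + h0 - e by apply: cvgB => //; exact: cvg_cst.
  rewrite addrAC subrr add0r => /cvg_norm/cvgr_lt/(_ _ h0r); apply: filterS => t.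
  exact: ltW.
have ts : \forall t \near (0 : R), `|t *: z| <= r2.
  exact: (cvgr0_norm_le _ tz).
have [r3 r30 r3P] : exists2 r3 : R, 0 < r3 & forall t, `|t| <= r3 ->
    [/\ dom (g t), `|c (g t) - e| <= r & `|t *: z| <= r2].
  by apply: near0_norm_le; near=> t; split; near: t.
pose t := Num.min r3 2^-1.
have t0 : 0 < t by rewrite lt_min r30 invr_gt0 ltr0n.
have t1 : t < 1.
  by apply: (le_lt_trans (_ : t <= 2^-1)); [rewrite ge_min lexx orbT|lra].
have [gd hrt tst] : [/\ dom (g t), `|c (g t) - e| <= r & `|t *: z| <= r2].
  by apply: r3P; rewrite gtr0_norm // ge_min lexx.
have eh : e + (c (g t) - e) = c (g t) by rewrite addrC subrK.
exists (c (g t) - e); rewrite eh; split=> //; first exact: chart_coord_cod.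
rewrite (chart_coordK gd) /g coAdM -/x0.
have [_ ex] := exp2 _ tst; rewrite linearZ -scalemxAl Az in ex.
set y := coAd _ x0 in ex *.
have -> : y - eta = (y - x0 - t *: w) - (1 - t) *: w.
  by rewrite scalerBl scale1r opprB addrA subrK /w opprB addrA subrK.
apply: (le_lt_trans (ler_normB _ _)).
rewrite normrZ (ger0_norm (_ : 0 <= 1 - t)); last by lra.
have -> : `|x0 - eta| = `|w| by rewrite distrC.
have : `|y - x0 - t *: w| <= t * (`|w| / 2).
  apply: (le_trans ex); rewrite normrZ gtr0_norm // mulrCA ler_wpM2l ?(ltW t0) //.
  rewrite mulrAC ler_pdivrMr ?mulr_gt0 // ?ltr_wpDl //.
  have z0 := normr_ge0 z; nra.
by move=> h; nra.
Unshelve. all: by end_near. Qed.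

(** Minimize the distance from the orbit to [eta] over the chart ball |h| <=
    r. The minimum is interior, since points of the boundary are too far from
    [xi], hence from [eta]; the matrix is still invertible there, so by
    [orbit_closer] the distance is zero. *)
Lemma orbit_near xi : tangent_mx xi \in unitmx ->
  \forall eta \near xi, coadjoint_orbit (G := G) eta = coadjoint_orbit (G := G) xi.
Proof.
move=> uM; have [k k0 kP] := tangent_lower_bound uM.
have [ru ru0 ruP] := tangent_unit_near uM.
have k20 : 0 < k / 2 by rewrite divr_gt0.
have [r1 r10 exp1] := orbit_expansion xi k20.
have [C C0 CP] := linear_rV_bounded A.
pose D := n%:R * C * `|xi| + k / 2.
have D0 : 0 < D by rewrite /D ltr_wpDl // !mulr_ge0 // ltW.
pose r := Num.min r1 (ru / D).
have r0 : 0 < r by rewrite lt_min r10 divr_gt0.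
have rP h : `|h| <= r -> [/\ cod (e + h),
    `|coAd (u (e + h) : G) xi - xi - A h *m xi| <= k / 2 * `|h| &
    `|coAd (u (e + h) : G) xi - xi| <= ru].
  rewrite le_min => /andP[hr1 hr2]; have [ch ex] := exp1 _ hr1; split=> //.
  rewrite -(subrK (A h *m xi) (_ - xi)); apply: (le_trans (ler_normD _ _)).
  have h1 : `|A h *m xi| <= n%:R * C * `|xi| * `|h|.
    apply: (le_trans (mulmx_norm_le _ _)).
    have -> : n%:R * C * `|xi| * `|h| = n%:R * (C * `|h|) * `|xi| by ring.
    by rewrite ler_wpM2r // ler_wpM2l.
  apply: (le_trans (lerD ex h1)); rewrite -mulrDl addrC -/D.
  by rewrite mulrC -ler_pdivlMr.
apply/nbhs_ballP; exists (k * r / 4); first by rewrite /= divr_gt0 // mulr_gt0.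
move=> eta; rewrite -ball_normE /= => etaxi.
pose K := [set h : 'rV[R]_n | `|h| <= r].
pose F h := `|coAd (u (e + h) : G) xi - eta|.
have F_cont : {within K, continuous F}.
  apply: continuous_in_subspaceT => h; rewrite inE => /rP[ch _ _].
  have h1 : coAd (u (e + k) : G) xi @[k --> h] --> coAd (u (e + h) : G) xi.
    exact: orbit_chart_continuous.
  exact: (cvg_norm (cvgB h1 (cvg_cst eta))).
have K0 : K 0 by rewrite /K /= normr0 ltW.
have [h0] := EVT_min_rV (ex_intro _ 0 K0) (@compact_norm_le R n r) F_cont.
rewrite inE => Kh0 h0min.
have F0 : F 0 < k * r / 4 by rewrite /F addr0 uncoord_e coAd1.
have Fh0 : F h0 < k * r / 4 by apply: le_lt_trans F0; apply: h0min; rewrite inE.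
have [ch0 ex0 ru_h0] := rP _ Kh0.
have h0r : `|h0| < r.
  rewrite lt_neqAle Kh0 andbT; apply/eqP => hr.
  have := kP h0; have : `|A h0 *m xi| <= F h0 + `|eta - xi| + k / 2 * `|h0|.
    have -> : A h0 *m xi = (coAd (u (e + h0) : G) xi - eta) + (eta - xi) -
      (coAd (u (e + h0) : G) xi - xi - A h0 *m xi).
      by rewrite addrA subrK opprB addrCA subrr addr0.
    apply: (le_trans (ler_normB _ _)); apply: lerD => //.
    exact: ler_normD.
  rewrite hr distrC => h1 h2; apply: (boundary_too_far h2 h1 Fh0 etaxi).
have [x0E|x0ne] := eqVneq (coAd (u (e + h0) : G) xi) eta.
  by apply: orbit_eq; exists (u (e + h0)).
have [h [hr ch hlt]] := orbit_closer (ruP _ ru_h0) ch0 h0r x0ne.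
by have := h0min h; rewrite inE => /(_ hr); rewrite leNgt hlt.
Qed.

End OrbitDirections.

(** * Points of open orbits have full rank *)

Section OrbitMap.
Context {R : realType} {n : nat} {G : lieGroupType R n}.
Local Notation c := (chart_coord (@chart1 R n G)).
Local Notation u := (chart_uncoord (@chart1 R n G)).
Local Notation dom := (chart_dom (@chart1 R n G)).
Local Notation cod := (chart_cod (@chart1 R n G)).
Local Notation e := (c 1%g).

(** Second countability: a countable family of translates of V covers the
    group. For every basic open set contained in some translate of V, one such
    translate is chosen. *)
Lemma countable_translates (V : set G) : nbhs (1%g : G) V ->
  exists g : nat -> G, forall x, exists i, exists2 v, V v & x = (g i * v)%g.
Proof.
move=> V1; have [B /countable_injP[f finj] [_ Bbasis]] := @manifold_second_countable R n G.
pose S i := [set g : G | exists2 U, B U /\ f U = i &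
  forall y, U y -> exists2 v, V v & y = (g * v)%g].
exists (fun i => xget 1%g (S i)) => x.
have Vx : nbhs x [set y | V (x^-1 * y)%g].
  have h : (x^-1 * y)%g @[y --> x] --> (x^-1 * x)%g.
    by apply: (@mulg_cvg R n G _ (nbhs x) (fun=> x^-1%g) id); [exact: cvg_cst|exact: cvg_id].
  by rewrite mulVg in h; exact: h V1.
have [U [BU Ux] UV] := Bbasis x _ Vx.
exists (f U).
have Sx : S (f U) x.
  exists U => // y /UV Vy; exists (x^-1 * y)%g => //.
  by rewrite mulgA mulgV mul1g.
case: xgetP => [g _ [U' [BU' fU'] U'V]|/(_ x)//].
by apply: U'V; rewrite (finj U' U) ?inE.
Qed.

(** The orbit is a countable union of translates of the compact image of a
    small ball, so one of these has an interior point, by Baire's theorem.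
    Moving this point back to [xi] replaces group elements b of the ball by
    quotients a^-1 b of two of them, which are still small. *)
Lemma orbit_map_open xi r : open (coadjoint_orbit (G := G) xi) -> 0 < r ->
  \forall eta \near xi, exists h : 'rV[R]_n,
    [/\ `|h| <= r, cod (e + h) & coAd (u (e + h) : G) xi = eta].
Proof.
move=> oO r0.
have near_div : \forall p \near ((1%g, 1%g) : G * G),
    dom (p.1^-1 * p.2)%g /\ `|c (p.1^-1 * p.2)%g - e| <= r.
  have h1 : (p.1^-1 * p.2)%g @[p --> ((1%g, 1%g) : G * G)] --> (1^-1 * 1 : G)%g.
    apply: mulg_cvg; last exact: cvg_snd.
    by apply: invg_cvg; exact: cvg_fst.
  rewrite invg1 mulg1 in h1.
  have h2 := h1 _ (near_dom dom1).
  have h3 : (c (p.1^-1 * p.2)%g) @[p --> ((1%g, 1%g) : G * G)] --> e.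
    exact: (cvg_comp _ _ h1 coord_cvg).
  have h4 : \forall p \near ((1%g, 1%g) : G * G), `|e - c (p.1^-1 * p.2)%g| <= r.
    by move/cvgrPdist_le : h3; apply.
  near=> p; split; first by near: p.
  by rewrite distrC; near: p.
have [[W1 W2] /= [W11 W21] W12] := near_div.
have uh : u (e + h) @[h --> (0 : 'rV[R]_n)] --> (1%g : G).
  have h1 : (e + h) @[h --> (0 : 'rV[R]_n)] --> e + 0.
    exact: (@cvgD _ _ _ (nbhs (0 : 'rV[R]_n)) _ (fun=> e) id e 0 (cvg_cst e) cvg_id).
  by rewrite addr0 in h1; exact: (cvg_comp _ _ h1 uncoord_cvg).
have [rho rho0 rhoP] : exists2 rho : R, 0 < rho & forall h : 'rV[R]_n, `|h| <= rho ->
    [/\ cod (e + h), W1 (u (e + h)) & W2 (u (e + h))].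
  apply: near0_norm_le; have k1 := @near_cod_e R n G; have k2 := uh _ W11; have k3 := uh _ W21.
  by near=> h; split; near: h.
pose K := [set h : 'rV[R]_n | `|h| <= rho].
pose V : set G := [set u (e + h) | h in K].
have V1 : nbhs (1%g : G) V.
  have k1 : \forall g \near (1%g : G), dom g := near_dom dom1.
  have k2 : \forall g \near (1%g : G), `|e - c g| <= rho.
    by have /cvgrPdist_le := @coord_cvg R n G; apply.
  near=> g; have gd : dom g by near: g.
  exists (c g - e); first by rewrite /K /= distrC; near: g.
  by rewrite addrC subrK chart_coordK.
have [g gV] := countable_translates V1.
pose F i : set 'cV[R]_n := [set coAd (g i) (coAd (u (e + h) : G) xi) | h in K].
have F_closed i : closed (F i).
  apply: compact_closed; first exact: norm_hausdorff.
  apply: continuous_compact; last exact: compact_norm_le.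
  apply: continuous_in_subspaceT => h; rewrite inE => /rhoP[ch _ _].
  have h1 : coAd (u (e + k) : G) xi @[k --> h] --> coAd (u (e + h) : G) xi.
    exact: orbit_chart_continuous.
  exact: (cvg_comp _ _ h1 (@coAd_continuous_vec R n G (g i) _)).
have [i [D [[y0 Dy0] oD DF]]] : exists i, exists D : set 'cV[R]_n,
    [/\ D !=set0, open D & D `<=` F i].
  apply: contrapT => noD.
  have FD i : open (~` F i) /\ dense (~` F i).
    split; first exact: closed_openC.
    move=> D D0 oD; apply: contrapT => DF; apply: noD; exists i, D; split => // y Dy.
    by apply: contrapT => Fy; apply: DF; exists y.
  have [|y [[x _ <-] Fx]] := Baire FD _ oO; first by exists xi; exact: orbit_refl.
  have [i [_ [h Kh <-] xE]] := gV x.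
  by apply: (Fx i I); exists h => //; rewrite xE coAdM.
have [h0 Kh0 y0E] := DF _ Dy0; set a := u (e + h0) in y0E.
have near_D : \forall eta \near xi, D (coAd (g i) (coAd a eta)).
  have oD' : open_nbhs (coAd (g i) (coAd a xi)) D by split => //; rewrite y0E.
  have h1 : coAd (g i) (coAd a eta) @[eta --> xi] --> coAd (g i) (coAd a xi).
    exact: (cvg_comp _ _ (@coAd_continuous_vec R n G a xi) (@coAd_continuous_vec R n G (g i) _)).
  exact: h1 _ (open_nbhs_nbhs oD').
apply: filterS near_D => eta /DF[h Kh hE].
have {}hE : coAd (u (e + h)) xi = coAd a eta.
  by rewrite -[LHS](coAdK (g i)) hE coAdK.
have [_ W1a _] := rhoP _ Kh0; have [_ _ W2b] := rhoP _ Kh.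
have [/= dab cab] := W12 (a, u (e + h)) (conj W1a W2b).
exists (c (a^-1 * u (e + h))%g - e).
have eh : e + (c (a^-1 * u (e + h))%g - e) = c (a^-1 * u (e + h))%g by rewrite addrC subrK.
rewrite eh chart_coordK //; split => //; first exact: chart_coord_cod.
by rewrite coAdM hE coAdK.
Unshelve. all: by end_near. Qed.
End OrbitMap.

(** Here a = |h|, b = |h - Y| and y = |Y|, and the left-hand side bounds the
    norm after a step s in the direction - Y: its terms come from (1 - s) h +
    s (h - Y), from the deviation of the translated velocity from Y, and from
    the remainder. *)
Lemma descent_arith (R : realFieldType) (s a b y : R) : 0 < s -> s < 1 -> 0 < a ->
  b <= a / 4 -> y <= a + b ->
  (1 - s) * a + s * b + s * (y / 8) + a / 8 * s < a.
Proof. by move=> s0 s1 a0 ba ya; nra. Qed.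

Section OpenOrbitTangent.
Context {R : realType} {n : nat} {G : lieGroupType R n}.
Local Notation c := (chart_coord (@chart1 R n G)).
Local Notation u := (chart_uncoord (@chart1 R n G)).
Local Notation dom := (chart_dom (@chart1 R n G)).
Local Notation cod := (chart_cod (@chart1 R n G)).
Local Notation e := (c 1%g).
Local Notation m := (fun p : 'rV[R]_n * 'rV[R]_n => c (u p.1 * u p.2)%g).
Variable A : {linear 'rV[R]_n -> 'M[R]_n}.
Hypothesis A_expansion : forall eps, 0 < eps ->
  \forall h \near (0 : 'rV[R]_n), `|coAd_mx (u (e + h) : G) - 1%:M - A h| <= eps * `|h|.

Lemma orbit_chart_is_diff xi :
  is_diff e (fun x => (coAd (u x : G) xi)^T) (tangent A xi).
Proof.
have tc : continuous (tangent A xi) by exact: linear_rV_continuous.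
apply/(is_diffP _ _ tc) => eps e0.
have [r r0 rP] := orbit_expansion A_expansion xi e0.
apply/nbhs_norm0P; exists r => //= h /ltW/rP[_].
by rewrite uncoord_e coAd1 -mx_norm_tr /tangent !linearB.
Qed.

(** The derivative of [coAd (gamma t) xi] at t is the image under [coAd (gamma
    t)] of the derivative at 0, which is [A Y *m xi]. *)
Lemma stabilizer_one_parameter (gamma : R -> G) Y xi : hom_with_velocity gamma Y ->
  A Y *m xi = 0 -> forall t, coAd (gamma t) xi = xi.
Proof.
move=> [hom gc gd gv] AY.
pose f t := (coAd (gamma t) xi)^T.
have F := orbit_chart_is_diff xi.
have [d0 d0E] := diff_comp_at (1 : R) gd (congr1 c (hom0 hom)) (@ex_diff _ _ _ _ _ _ _ F).
have gdom : \forall t \near (0 : R), dom (gamma t) by exact: gc _ (near_dom dom1).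
have E : \forall t \near (0 : R), ((fun x => (coAd (u x : G) xi)^T) \o (c \o gamma)) t = f t.
  by apply: filterS gdom => t dt; rewrite /= (chart_coordK dt).
have f0 : differentiable f 0 := (near_eq_is_diff E d0).1.
have f0E : 'd f 0 1 = 0.
  apply: (etrans (near_eq_diff (1 : R) E d0)); apply: (etrans d0E).
  apply: (etrans (congr1 _ gv)).
  apply: (etrans (congr1 (fun k => k Y) (@diff_val _ _ _ _ _ _ _ F))).
  by rewrite /tangent AY trmx0.
have loc t : differentiable f t /\ 'd f t 1 = 0.
  pose N := (coAd_mx (gamma t))^T.
  pose L : {linear 'rV[R]_n -> 'rV[R]_n} := mulmxr N.
  have Lc : continuous L by exact: linear_rV_continuous.
  have [d1 d1E] := diff_comp_at (1 : R) f0 erefl (linear_differentiable (f 0) Lc).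
  have E' : \forall s \near (0 : R), (L \o f) s = f (t + s).
    by near=> s; rewrite /= /f hom coAdM /N -trmx_mul.
  have [d2 d2E] := is_diff_shift (1 : R) (near_eq_is_diff E' d1).1.
  split; first exact: d2.
  have z0 : 'd L (f 0) 0 = 0 by exact: linear0.
  exact: (etrans d2E (etrans (near_eq_diff (1 : R) E' d1)
    (etrans d1E (etrans (congr1 ('d L (f 0)) f0E) z0)))).
move=> t; have ft : f t = f 0.
  by apply: (@constant_of_diff_eq0 R n f (`|t| + 1)) => [s _|]; [exact: loc|rewrite ltrDl].
by apply: trmx_inj; rewrite -/(f t) ft /f (hom0 hom) coAd1.
Unshelve. all: by end_near. Qed.

Lemma mulg_curve_expansion x (gamma : R -> G) Y : cod x -> hom_with_velocity gamma Y ->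
  forall eps, 0 < eps ->
  exists2 r : R, 0 < r & forall s, `|s| <= r ->
    dom (u x * gamma s)%g /\ `|c (u x * gamma s)%g - x - s *: dmul_right (G := G) x Y| <= eps * `|s|.
Proof.
move=> xc [hom gc gd gv] eps e0; apply: near0_norm_le.
have [d1 d1E] := @dmul_rightE R n G x Y xc.
have [d2 d2E] := diff_comp_at (1 : R) gd (congr1 c (hom0 hom)) d1.
have dc : continuous ('d ((fun y => m (x, y)) \o (c \o gamma)) 0) by apply: diff_continuous.
have := (is_diffP _ _ dc).1 (differentiableP d2) eps e0.
have gdom : \forall t \near (0 : R), dom (gamma t) by exact: gc _ (near_dom dom1).
have ug : (u x * gamma t)%g @[t --> (0 : R)] --> (u x * 1 : G)%g.
  by apply: mulg_cvg => //; exact: cvg_cst.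
rewrite mulg1 in ug.
have xd := chart_uncoord_dom xc.
have ugdom : \forall t \near (0 : R), dom (u x * gamma t)%g by exact: ug _ (near_dom xd).
move=> H; near=> s; have gs : dom (gamma s) by near: s.
split; first by near: s.
have : `|((fun y => m (x, y)) \o (c \o gamma)) (0 + s) -
    ((fun y => m (x, y)) \o (c \o gamma)) 0 -
    'd ((fun y => m (x, y)) \o (c \o gamma)) 0 s| <= eps * `|s| by near: s.
have -> : 'd ((fun y => m (x, y)) \o (c \o gamma)) 0 s = s *: dmul_right (G := G) x Y.
  rewrite -[s in LHS]mulr1 -[s * 1]/(s *: (1 : R)) linearZ; congr (_ *: _).
  apply: (etrans d2E); apply: (etrans (congr1 _ gv)); exact: esym.
by rewrite /= add0r (hom0 hom) (chart_coordK gs) uncoord_e mulg1 (chart_uncoordK xc).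
Unshelve. all: by end_near. Qed.

(** The factor 1/8 leaves enough room in [descent_arith]. *)
Lemma dmul_right_near : exists2 r : R, 0 < r & forall h, `|h| <= r ->
  cod (e + h) /\ forall Y, `|dmul_right (G := G) (e + h) Y - Y| <= `|Y| / 8.
Proof.
have J2e : lin1_mx (@dmul_right R n G e) = 1%:M.
  by apply/row_matrixP => i; rewrite !rowE mulmx1 mul_rV_lin1 /= dmul_right_e.
have [B HB] := lin1_mx_expansion J2e (@dmul_right_differentiable R n G).
have [C C0 CP] := linear_rV_bounded B.
have N0 : 0 < n%:R * (C + 1) + 1 :> R by rewrite ltr_wpDl // mulr_ge0 // addr_ge0 // ltW.
apply: near0_norm_le; have h1 := @near_cod_e R n G; have h2 := HB 1 ltr01.
have h3 : \forall h \near (0 : 'rV[R]_n), `|h| < (8 * (n%:R * (C + 1) + 1))^-1.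
  by apply: nbhs0_lt; rewrite invr_gt0 mulr_gt0.
near=> h; split; first by near: h.
move=> Y.
have hB : `|lin1_mx (dmul_right (G := G) (e + h)) - 1%:M - B h| <= 1 * `|h| by near: h.
have hs : `|h| <= (8 * (n%:R * (C + 1) + 1))^-1 by apply: ltW; near: h.
have -> : dmul_right (G := G) (e + h) Y - Y = Y *m (lin1_mx (dmul_right (G := G) (e + h)) - 1%:M).
  by rewrite mulmxBr mulmx1; congr (_ - _); exact: (esym (mul_rV_lin1 (dmul_right (e + h)) Y)).
apply: (le_trans (mulmx_norm_le _ _)).
have hE : `|lin1_mx (dmul_right (G := G) (e + h)) - 1%:M| <= (C + 1) * `|h|.
  rewrite -(subrK (B h) (lin1_mx _ - _)); apply: (le_trans (ler_normD _ _)).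
  by apply: (le_trans (lerD hB (CP h))); rewrite -mulrDl addrC.
apply: (le_trans (ler_wpM2l _ hE)); first by rewrite mulr_ge0.
have -> : n%:R * `|Y| * ((C + 1) * `|h|) = `|Y| * ((n%:R * (C + 1)) * `|h|) by ring.
rewrite ler_wpM2l //; apply: (le_trans (ler_wpM2l _ hs)).
  by rewrite mulr_ge0 // addr_ge0 // ltW.
rewrite invfM mulrCA ger_pMr ?invr_gt0 // ler_pdivrMr // mul1r lerDl //.
Unshelve. all: by end_near. Qed.
End OpenOrbitTangent.

(** With the notations of [open_orbit_unit]: the point at distance s is
    reached by an element of norm h; the lower bound k gives h = O(s), while
    the pairing with w, nonzero by th, gives s = o(h). *)
Lemma no_small_slope (R : realFieldType) (s h eps k th b : R) :
  0 < s -> 0 < k -> 0 < th -> 0 <= b -> 0 <= h ->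
  s * th <= b * (eps * h) -> k * h <= s + eps * h ->
  eps = Num.min (k / 2) (k * th / (4 * (b + 1))) -> False.
Proof.
move=> s0 k0 th0 b0 h0 H1 H2 epsE.
have e1 : eps <= k / 2 by rewrite epsE ge_min lexx.
have e2 : eps <= k * th / (4 * (b + 1)) by rewrite epsE ge_min lexx orbT.
have b1 : 0 < 4 * (b + 1) by lra.
have {}e2 : eps * (4 * (b + 1)) <= k * th by rewrite -ler_pdivlMr.
have e0 : 0 < eps.
  by rewrite epsE lt_min divr_gt0 //= divr_gt0 // mulr_gt0.
have h2 : k * h <= 2 * s by nra.
have h3 : s * th * k <= b * eps * (2 * s).
  apply: (le_trans (_ : _ <= b * eps * (k * h))); first by nra.
  by rewrite ler_wpM2l // mulr_ge0 // ltW.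
have h4 : th * k <= b * eps * 2 by nra.
nra.
Qed.

Section OpenOrbitUnit.
Context {R : realType} {n : nat} {G : lieGroupType R n}.
Local Notation c := (chart_coord (@chart1 R n G)).
Local Notation u := (chart_uncoord (@chart1 R n G)).
Local Notation dom := (chart_dom (@chart1 R n G)).
Local Notation cod := (chart_cod (@chart1 R n G)).
Local Notation e := (c 1%g).
Variable A : {linear 'rV[R]_n -> 'M[R]_n}.
Hypothesis A_expansion : forall eps, 0 < eps ->
  \forall h \near (0 : 'rV[R]_n), `|coAd_mx (u (e + h) : G) - 1%:M - A h| <= eps * `|h|.
Hypothesis G_exp : exponential G.

(** Suppose that |A h xi| is much smaller than |h|. Then h is close to its
    component Y in the kernel of [z |-> A z *m xi]. The one-parameter subgroup
    of velocity - Y fixes [xi], so multiplying by it does not change the image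
    of [xi], but it shortens h: this is impossible if h has least norm. *)
Lemma min_norm_lower_bound (xi : 'cV[R]_n) : exists2 k : R, 0 < k & exists2 r0 : R, 0 < r0 &
  forall h, `|h| <= r0 ->
    (forall h', cod (e + h') -> coAd (u (e + h') : G) xi = coAd (u (e + h)) xi -> `|h| <= `|h'|) ->
    k * `|h| <= `|A h *m xi|.
Proof.
pose M := tangent_mx A xi; pose P := pinvmx M.
pose N := 4 * (n%:R * `|P| + 1).
have N0 : 0 < N by rewrite mulr_gt0 // ltr_wpDl // mulr_ge0.
exists N^-1; first by rewrite invr_gt0.
have [r r0 rP] := @dmul_right_near R n G; exists r => // h hr hmin.
rewrite leNgt; apply/negP => small.
have h0 : 0 < `|h|.
  rewrite lt_neqAle normr_ge0 andbT; apply/eqP => h00.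
  by move: small; rewrite -h00 mulr0 ltNge normr_ge0.
have [ch J2h] := rP _ hr.
(* h *m M *m P has the same image under M as h, and is bounded by that image *)
pose Y := h - h *m M *m P.
have YM : Y *m M = 0 by rewrite mulmxBl mulmxKpV ?subrr // submxMl.
have AY : A (- Y) *m xi = 0.
  by apply: trmx_inj; rewrite -mul_tangent_mx mulNmx YM oppr0 trmx0.
have hY : `|h - Y| <= `|h| / 4.
  rewrite /Y opprB addrC subrK; apply: (le_trans (mulmx_norm_le _ _)).
  rewrite mul_tangent_mx mx_norm_tr mulrAC.
  apply: (le_trans (ler_wpM2l _ (ltW small))); first by rewrite mulr_ge0.
  rewrite mulrA [leRHS]mulrC ler_wpM2r // ler_pdivrMr // /N.
  by rewrite mulrA mulVf ?pnatr_eq0 // mul1r lerDl.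
have nY : `|Y| <= `|h| + `|h - Y|.
  by rewrite -{1}(subKr h Y); exact: ler_normB.
have [gamma _ hg] := one_parameter_exists (- Y) G_exp.
have stab := stabilizer_one_parameter A_expansion hg AY.
have h80 : 0 < `|h| / 8 by rewrite divr_gt0.
have [r1 r10 r1P] := mulg_curve_expansion ch hg h80.
pose s := Num.min r1 2^-1.
have s0 : 0 < s by rewrite lt_min r10 invr_gt0 ltr0n.
have s1 : s < 1.
  by apply: (le_lt_trans (_ : s <= 2^-1)); [rewrite ge_min lexx orbT|rewrite invf_lt1 ?ltr1n].
have [ds exs] : dom (u (e + h) * gamma s)%g /\
    `|c (u (e + h) * gamma s)%g - (e + h) - s *: dmul_right (G := G) (e + h) (- Y)| <= `|h| / 8 * `|s|.
  by apply: r1P; rewrite gtr0_norm // ge_min lexx.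
pose h' := c (u (e + h) * gamma s)%g - e.
have eh' : e + h' = c (u (e + h) * gamma s)%g by rewrite addrC subrK.
have hh' : `|h| <= `|h'|.
  apply: hmin; rewrite eh'; first exact: chart_coord_cod.
  by rewrite (chart_coordK ds) coAdM stab.
suff : `|h'| < `|h| by rewrite ltNge hh'.
apply: le_lt_trans (descent_arith s0 s1 h0 hY nY).
have -> : h' = (1 - s) *: h + s *: (h - Y) - s *: (dmul_right (G := G) (e + h) Y - Y) +
    (c (u (e + h) * gamma s)%g - (e + h) - s *: dmul_right (G := G) (e + h) (- Y)).
  have JN : dmul_right (G := G) (e + h) (- Y) = - dmul_right (G := G) (e + h) Y.
    exact: (linearN (dmul_right (e + h))).
  rewrite /h' JN; move: (dmul_right (e + h) Y) (c (_ * _)%g) => j x.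
  by apply/rowP => i; rewrite !mxE; ring.
rewrite (gtr0_norm s0) in exs.
apply: (le_trans (ler_normD _ _)); apply: lerD => //.
apply: (le_trans (ler_normB _ _)); apply: lerD; last first.
  by rewrite normrZ gtr0_norm // ler_wpM2l ?(ltW s0).
apply: (le_trans (ler_normD _ _)).
by rewrite !normrZ (gtr0_norm s0) ger0_norm // subr_ge0 ltW.
Qed.

(** Otherwise a nonzero covector w kills the range of [z |-> A z *m xi].
    Choose j with [w 0 j != 0]. The points xi + s e_j are reached by small h,
    as the orbit map is open, and the h of least norm satisfies |h| = O(s) by
    [min_norm_lower_bound]. But the pairing with w sees only the remainder of
    the expansion, so that s = o(|h|). *)
Lemma open_orbit_unit (xi : 'cV[R]_n) :
  open (coadjoint_orbit (G := G) xi) -> tangent_mx A xi \in unitmx.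
Proof.
move=> oO; apply: contrapT => nu.
have [w w0 wM] : exists2 w : 'rV[R]_n, w != 0 & w *m (tangent_mx A xi)^T = 0.
  apply: contrapT => now; apply: nu; rewrite -unitmx_tr; apply: unitmx_inj => z zM.
  by apply/eqP; apply/negP => /negP z0; apply: now; exists z.
have [j wj] : exists j, w 0 j != 0.
  apply: contrapT => now; move/eqP: w0; apply; apply/rowP => j; rewrite mxE.
  by apply/eqP; apply/negP => /negP wj; apply: now; exists j.
have [k k0 [r0 r00 kP]] := min_norm_lower_bound xi.
pose b := n%:R * `|w|; have b0 : 0 <= b by rewrite mulr_ge0.
pose th := `|w 0 j|; have th0 : 0 < th by rewrite normr_gt0.
(* the first bound absorbs the remainder in k * |h|; the second one makes
   the pairing of the remainder with w smaller than s * |w 0 j| *)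
pose eps := Num.min (k / 2) (k * th / (4 * (b + 1))).
have e0 : 0 < eps.
  by rewrite lt_min divr_gt0 //= divr_gt0 ?mulr_gt0 // ltr_wpDl.
have [r1 r10 r1P] := orbit_expansion A_expansion xi e0.
pose r := Num.min r0 r1; have rr0 : 0 < r by rewrite lt_min r00 r10.
have /nbhs_normP[d /= d0 dP] := orbit_map_open oO rr0.
pose s := d / 2; have s0 : 0 < s by rewrite divr_gt0.
pose eta := xi + s *: delta_mx j 0.
have ns : `|s *: delta_mx j 0 : 'cV[R]_n| <= s.
  apply: mx_norm_le => [|i i']; first exact: ltW.
  by rewrite !mxE; case: (_ && _); rewrite ?mulr1 ?mulr0 ?normr0 ?gtr0_norm // ltW.
have [h1 [h1r ch1 h1E]] : exists h,
    [/\ `|h| <= r, cod (e + h) & coAd (u (e + h) : G) xi = eta].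
  apply: dP; rewrite /= /eta opprD addrA subrr sub0r normrN.
  by apply: (le_lt_trans ns); rewrite ltr_pdivrMr // ltr_pMr // ltr1n.
pose S := [set h : 'rV[R]_n | `|h| <= r /\ coAd (u (e + h) : G) xi = eta].
have hr0 (h : 'rV[R]_n) : `|h| <= r -> `|h| <= r0 by rewrite le_min => /andP[].
have hr1 (h : 'rV[R]_n) : `|h| <= r -> `|h| <= r1 by rewrite le_min => /andP[].
have S_compact : compact S.
  have -> : S = [set h | `|h| <= r] `&` S by apply/seteqP; split => h [? ?] //; case.
  apply: compact_closedI; first exact: compact_norm_le.
  rewrite -[S]setCK; apply: open_closedC; rewrite openE => h nS.
  have [hr|rh] := leP `|h| r; last first.
    have far : \forall h' \near h, r < `|h'|.
      exact: (cvgr_gt _ (@norm_continuous _ _ h)).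
    by apply: filterS far => h' rh' [/= h'r _]; move: rh'; rewrite ltNge h'r.
  have [ch _] := r1P _ (hr1 _ hr).
  have ne : coAd (u (e + h) : G) xi != eta by apply/eqP => hE; exact: nS.
  have sc : coAd (u (e + h') : G) xi - eta @[h' --> h] --> coAd (u (e + h) : G) xi - eta.
    have oc : coAd (u (e + h') : G) xi @[h' --> h] --> coAd (u (e + h) : G) xi.
      exact: orbit_chart_continuous.
    exact: (cvgB oc (cvg_cst eta)).
  rewrite -subr_eq0 in ne.
  have near_ne : \forall h' \near h, coAd (u (e + h') : G) xi - eta != 0.
    exact: (cvgr_neq0 _ sc ne).
  by apply: filterS near_ne => h' + [_ h'E]; rewrite h'E subrr eqxx.
have norm_cont : {within S, continuous (fun h : 'rV[R]_n => `|h|)}.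
  by apply: continuous_in_subspaceT => h _; exact: norm_continuous.
have [h] := EVT_min_rV (ex_intro _ h1 (conj h1r h1E)) S_compact norm_cont.
move=> /set_mem[hr hE] hmin.
have kh : k * `|h| <= `|A h *m xi|.
  apply: kP; first exact: hr0.
  move=> h' ch' h'E; have [h'r|/ltW h'r] := leP `|h'| r; last exact: le_trans hr h'r.
  exact: (hmin _ (mem_set (conj h'r (etrans h'E hE)))).
have [_] := r1P _ (hr1 _ hr); rewrite hE /eta [xi + _]addrC addrK => ex.
apply: (@no_small_slope R s `|h| eps k th b) => //.
  have Az0 : w *m (A h *m xi) = 0.
    have Mw : tangent_mx A xi *m w^T = 0.
      by apply: trmx_inj; rewrite trmx_mul trmxK wM trmx0.
    by apply: trmx_inj; rewrite trmx_mul -mul_tangent_mx trmx0 -mulmxA Mw mulmx0.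
  have : `|w *m (s *: delta_mx j 0 - A h *m xi)| <= b * (eps * `|h|).
    apply: (le_trans (mulmx_norm_le _ _)); rewrite -/b ler_wpM2l //.
  rewrite mulmxBr Az0 subr0 -scalemxAr => /(le_trans _); apply.
  have E : (s *: (w *m (delta_mx j 0 : 'cV[R]_n))) 0 0 = s * w 0 j.
    by rewrite -colE !mxE.
  have := ler_mx_entry (s *: (w *m (delta_mx j 0 : 'cV[R]_n))) 0 0.
  by rewrite E normrM (gtr0_norm s0).
apply: (le_trans kh); rewrite -[A h *m xi](subKr (s *: delta_mx j 0)).
by apply: (le_trans (ler_normB _ _)); apply: lerD.
Qed.
End OpenOrbitUnit.

(** * Counting the open orbits *)

Lemma even_card_involution (K : choiceType) (f : K -> K) (X : {fset K}) :
  {in X, forall x, [/\ f x \in X, f (f x) = x & f x != x]} -> ~~ odd #|` X|%fset.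
Proof.
have [k] := ubnP #|` X|%fset; elim: k X => // k IH X Xk fX.
have [->|[x xX]] := fset_0Vmem X; first by rewrite cardfs0.
have [fxX ffx fxx] := fX x xX.
have fxX' : f x \in (X `\ x)%fset by rewrite !inE fxx.
have cX : #|` X|%fset = (#|` (X `\ x `\ f x)|%fset).+2.
  by rewrite (cardfsD1 x) xX (cardfsD1 (f x) (X `\ x)%fset) fxX'.
rewrite cX /= negbK; apply: IH; first by move: Xk; rewrite cX ltnS => /ltnW.
move=> y; rewrite !inE => /and3P[yfx yx yX]; have [fyX ffy fyy] := fX y yX.
rewrite fyX andbT; split=> //; apply/andP; split.
  by apply: contraNneq yx => E; rewrite -ffy E ffx.
by apply: contraNneq yfx => <-; rewrite ffy.
Qed.

Section Counting.
Context {R : realType} {n : nat} {G : lieGroupType R n}.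
Hypothesis G_exp : exponential G.

Lemma finite_open_orbits : finite_set (open_coadjoint_orbits G).
Proof.
have [A HA] := @coAd_expansion R n G.
pose M (v : 'cV[R]_n) : 'M[R]_n := \matrix_(i, j) \sum_k A (delta_mx 0 i) j k * v k 0.
have ME v : \det (M v) != 0 = (tangent_mx A v \in unitmx).
  by rewrite unitmxE unitfE tangent_mxE.
have := @finite_image_det_neq0 R n _ (fun i j k => A (delta_mx 0 i) j k)
  (coadjoint_orbit (G := G)).
rewrite /= -/M => fin; apply: sub_finite_set (fin _).
  move=> O [oO [xi OE]]; exists xi => //=; rewrite ME.
  by apply: (open_orbit_unit HA G_exp); rewrite -OE.
by move=> v; rewrite ME => uv; exact: (orbit_near HA uv).
Qed.

Definition opp_orbit (O : set 'cV[R]_n) : set 'cV[R]_n := [set - x | x in O].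

Lemma opp_orbitK : involutive opp_orbit.
Proof.
move=> O; apply/seteqP; split => x; first by move=> [_ [y Oy <-] <-]; rewrite opprK.
by move=> Ox; exists (- x); [exists x|rewrite opprK].
Qed.

Lemma opp_orbit_open O : open_coadjoint_orbits G O -> open_coadjoint_orbits G (opp_orbit O).
Proof.
move=> [oO [xi OE]]; split.
  have -> : opp_orbit O = -%R @^-1` O.
    apply/seteqP; split => x /=; first by move=> [y Oy <-]; rewrite opprK.
    by move=> Ox; exists (- x) => //; rewrite opprK.
  by apply: open_comp => // x _; exact: opp_continuous.
exists (- xi); rewrite OE; apply/seteqP; split => x.
  by move=> [_ [g _ <-] <-]; exists g => //; rewrite /coAd mulmxN.
by move=> [g _ <-]; exists (coAd g xi); [exists g|rewrite /coAd mulmxN].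
Qed.

(** Positive dimension enters here: for n = 0 the orbit {0} is open and equal
    to its opposite. *)
Lemma opp_orbit_neq O : (0 < n)%N -> open_coadjoint_orbits G O -> opp_orbit O <> O.
Proof.
move=> n0 [oO [xi OE]] OO.
have [g _ gE] : coadjoint_orbit (G := G) xi (- xi).
  by rewrite -OE -OO; exists xi => //; rewrite OE; exact: orbit_refl.
have xi0 := coAd_opp_eq0 G_exp gE.
have O0 x : O x -> x = 0 by rewrite OE xi0 => -[h _ <-]; rewrite /coAd mulmx0.
have O00 : O 0 by have := @orbit_refl R n G xi; rewrite -OE xi0.
have : open_nbhs 0 O by [].
move=> /open_nbhs_nbhs/nbhs_norm0P[d /= d0 dO].
pose i := Ordinal n0; pose v : 'cV[R]_n := (d / 2) *: delta_mx i 0.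
have /O0 v0 : O v.
  apply: dO; apply: (@le_lt_trans _ _ (d / 2)); last first.
    by rewrite ltr_pdivrMr // ltr_pMr // ltr1n.
  apply: mx_norm_le => [|j k]; first by rewrite divr_ge0 // ltW.
  rewrite !mxE; case: (_ && _); rewrite ?mulr1 ?mulr0 ?normr0 ?gtr0_norm //.
  - by rewrite divr_gt0.
  - by rewrite divr_ge0 // ltW.
have := congr1 (fun w : 'cV[R]_n => w i 0) v0; rewrite !mxE !eqxx mulr1 => /eqP.
by rewrite mulf_eq0 invr_eq0 pnatr_eq0 orbF gt_eqF.
Qed.
End Counting.

Theorem proposition6p1 (R : realType) (n : nat) (n_gt0 : (0 < n)%N)
    (G : lieGroupType R n) (G_exp : exponential G) :
  finite_set (open_coadjoint_orbits G) /\
  ~~ odd #|` fset_set (open_coadjoint_orbits G)|%fset.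
Proof.
have fin := finite_open_orbits G_exp; split=> //.
apply: (even_card_involution (f := @opp_orbit R n)) => O.
rewrite in_fset_set // => /set_mem OO; split.
- by rewrite in_fset_set //; apply/mem_set; exact: opp_orbit_open.
- exact: opp_orbitK.
- by apply/eqP; exact: (opp_orbit_neq G_exp n_gt0 OO).
Qed.
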